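(* Let $U=\begin{pmatrix} a & b\\ c & d\end{pmatrix}$ be a $2\times 2$ unitary matrix with $abcd\neq 0$ and let $\varphi={}^t[\alpha,\beta]\in\mathbf{C}^2$ with $|\alpha|^2+|\beta|^2=1$. Then as $n\to\infty$, $X_n^{\varphi}/n$ converges in distribution to a random variable $Z^{\varphi}$ having density $$f(x;{}^t[\alpha,\beta])=\frac{\sqrt{1-|a|^2}}{\pi(1-x^2)\sqrt{|a|^2-x^2}}\left\{1-\left(|\alpha|^2-|\beta|^2+\frac{a\alpha\overline{b\beta}+\overline{a\alpha}b\beta}{|a|^2}\right)x\right\}$$ for $x\in(-|a|,|a|)$ (and $0$ elsewhere). Moreover $$E(Z^{\varphi})=-\left(|\alpha|^2-|\beta|^2+\frac{a\alpha\overline{b\beta}+\overline{a\alpha}b\beta}{|a|^2}\right)\left(1-\sqrt{1-|a|^2}\right),\qquad E\big((Z^{\varphi})^2\big)=1-\sqrt{1-|a|^2}.$$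
   Context: Quantum random walk on $\mathbf{Z}$ determined by a $2\times2$ unitary matrix $U=\begin{pmatrix} a & b\\ c & d\end{pmatrix}$: set $P=\begin{pmatrix} a & b\\ 0&0\end{pmatrix}$, $Q=\begin{pmatrix} 0&0\\ c & d\end{pmatrix}$. Given an initial qubit state $\varphi={}^t[\alpha,\beta]\in\mathbf{C}^2$ with $|\alpha|^2+|\beta|^2=1$, define amplitudes $\Psi_k(n)\in\mathbf{C}^2$ ($k\in\mathbf{Z}$, $n\ge0$) by $\Psi_0(0)=\varphi$, $\Psi_k(0)=0$ for $k\neq0$, and $\Psi_k(n+1)=P\Psi_{k+1}(n)+Q\Psi_{k-1}(n)$. The random variable $X_n^{\varphi}$ takes value $k$ with probability $\|\Psi_k(n)\|^2$. $\overline{z}$ denotes complex conjugate. *)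

(* Defs.v *)
From HB Require Import structures.
From mathcomp Require Import all_boot all_order all_algebra.
From mathcomp Require Import complex.
From mathcomp Require Import all_classical all_reals all_analysis.
Set Implicit Arguments. Unset Strict Implicit. Unset Printing Implicit Defensive.
Import Order.TTheory GRing.Theory Num.Theory.
Import numFieldNormedType.Exports.
Local Open Scope ring_scope.

Section QW.
Variable R : realType.
Local Notation C := R[i].

Definition cabs (z : C) : R := Normc.normc z.

Definition mx2 (a b c d : C) : 'M[C]_2 :=
  \matrix_(i < 2, j < 2)
    if i == 0 then (if j == 0 then a else b) else (if j == 0 then c else d).

Definition unitary2 (a b c d : C) : Prop :=
  mx2 a b c d *m (map_mx (@conjc R) (mx2 a b c d))^T = 1%:M.

Definition qubit (alpha beta : C) : 'cV[C]_2 :=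
  \col_(i < 2) if i == 0 then alpha else beta.

Definition Pmx (a b c d : C) : 'M[C]_2 := mx2 a b 0 0.
Definition Qmx (a b c d : C) : 'M[C]_2 := mx2 0 0 c d.

Fixpoint qw_amp (a b c d alpha beta : C) (n : nat) : int -> 'cV[C]_2 :=
  match n with
  | O => fun k => if k == 0 then qubit alpha beta else 0
  | m.+1 => fun k => Pmx a b c d *m qw_amp a b c d alpha beta m (k + 1)
                   + Qmx a b c d *m qw_amp a b c d alpha beta m (k - 1)
  end.

Definition qw_prob (a b c d alpha beta : C) (n : nat) (k : int) : R :=
  \sum_(i < 2) cabs (qw_amp a b c d alpha beta n k i 0) ^+ 2.

(* P(X_n / n <= t); X_n is supported in {-n, ..., n} *)
Definition qw_cdf (a b c d alpha beta : C) (n : nat) (t : R) : R :=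
  \sum_(0 <= i < (2 * n).+1)
     (let k : int := (i%:Z - n%:Z)%R in
      if k%:~R / n%:R <= t then qw_prob a b c d alpha beta n k else 0).

(* the coefficient |alpha|^2 - |beta|^2 + (a alpha conj(b beta) + conj(a alpha) b beta)/|a|^2;
   the complex quantity z + conj z is real, we take its real part *)
Definition qw_lambda (a b alpha beta : C) : R :=
  cabs alpha ^+ 2 - cabs beta ^+ 2
  + complex.Re ((a * alpha * conjc (b * beta) + conjc (a * alpha) * (b * beta))
        / ((cabs a ^+ 2)%:C)%C).

Definition qw_density (a b alpha beta : C) (x : R) : R :=
  if `|x| < cabs a then
    Num.sqrt (1 - cabs a ^+ 2)
      / (pi * (1 - x ^+ 2) * Num.sqrt (cabs a ^+ 2 - x ^+ 2))
    * (1 - qw_lambda a b alpha beta * x)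
  else 0.

End QW.

(* Main.v *)
Require Import Defs.
From HB Require Import structures.
From mathcomp Require Import all_boot all_order all_algebra.
From mathcomp Require Import complex ring lra zify.
From mathcomp Require Import all_classical all_reals all_analysis.
From mathcomp Require Import measurable_realfun.
Import Order.TTheory GRing.Theory Num.Theory.
Import numFieldNormedType.Exports.
Local Open Scope classical_set_scope.
Local Open Scope ring_scope.

(** In Fourier space one step of the walk is multiplication by a unitary 2x2
    matrix which, up to a constant phase and a translation of the frequency
    [th], equals [r cos th + chi(th)] with [r = |a|] and [chi(th)] traceless
    skew-hermitian, so that its [n]-th power is
    [cos (n om) + sin (n om) / sin om * chi(th)] where [cos om = r cos th].
    By Parseval, [E exp(i xi X_n / n)] is the average over [th] of the inner
    product of the states at [th] and [th + xi / n]; by dominated convergence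
    it tends to the average of
    [cos (xi v) + i <phi, chi phi> / (i sin om) * sin (xi v)] with [v = om'].
    After discarding odd terms this is the average of
    [(1 - lambda v) exp(i xi v)] over [|th| <= pi / 2], and the substitution
    [x = v(th)] turns it into the Fourier transform of the announced density.
    As all the laws live on [-1, 1], convergence of the characteristic
    functions gives convergence of the expectations of polynomials in
    [sin (x / 2)], and Weierstrass' theorem gives that of the distribution
    functions. *)

(** * Weierstrass approximation of Lipschitz functions *)

(** Parseval controls sines and cosines of every frequency. A factor [sin (x / 2)] only shifts a
    frequency by one half, so powers of it are controlled as well; on [[-1, 1]] it is bounded and
    increasing, hence a coordinate in which a step can be squeezed between Lipschitz ramps. For
    these the quantitative Bernstein estimate suffices. Two obstacles shape the rest. The density
    has a singular factor at [x = r] and [x = - r], exactly where [v'] vanishes; the substitution is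
    therefore made on smaller intervals and extended by monotone convergence, first for nonnegative
    test functions, then for signed ones by adding a constant. And the density is nonnegative only
    if [|lambda| r <= 1]: this is Cauchy-Schwarz for [<phi, chi phi>] at [th = pi / 2], where that
    product equals [- i lambda r]. The same inequality supplies the dominating constant for the
    Fourier integrals. *)

Definition bernstein {R : realType} (g : R -> R) (n : nat) : {poly R} :=
  \sum_(i < n.+1) (g (i%:R / n%:R) * 'C(n, i)%:R) *: ('X^i * (1 - 'X) ^+ (n - i)).

Lemma horner_bernstein {R : realType} (g : R -> R) n x :
  (bernstein g n).[x] =
  \sum_(i < n.+1) g (i%:R / n%:R) * ('C(n, i)%:R * x ^+ i * (1 - x) ^+ (n - i)).
Proof.
rewrite /bernstein horner_sum; apply: eq_bigr => i _.
by rewrite !hornerE; ring.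
Qed.

Lemma bernstein1 {R : realType} n (x : R) :
  \sum_(i < n.+1) ('C(n, i)%:R * x ^+ i * (1 - x) ^+ (n - i)) = 1.
Proof.
transitivity (((1 - x) + x) ^+ n); last by rewrite subrK expr1n.
rewrite exprDn; apply: eq_bigr => i _.
by rewrite -[RHS]mulr_natr [RHS]mulrC [in RHS](mulrC ((1 - x) ^+ _)) mulrA.
Qed.

(** Absorption identity [i * C(n+1, i) = (n+1) * C(n, i-1)]: each factor [i] lowers the binomial law
    by one trial, so two uses give its first two moments. *)
Lemma sum_bin_shift {R : realType} n (h : nat -> R) (x y : R) :
  \sum_(i < n.+2) h i * (i%:R * ('C(n.+1, i)%:R * x ^+ i * y ^+ (n.+1 - i))) =
  n.+1%:R * x * \sum_(i < n.+1) h i.+1 * ('C(n, i)%:R * x ^+ i * y ^+ (n - i)).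
Proof.
rewrite big_ord_recl /= mul0r mulr0 add0r mulr_sumr; apply: eq_bigr => i _.
rewrite /bump /= add1n subSS.
have /(congr1 (fun k : nat => k%:R : R)) := mul_bin_diag n.+1 i.
rewrite /= !natrM => E.
transitivity (h i.+1 * ((i.+1%:R * 'C(n.+1, i.+1)%:R) * x ^+ i.+1 * y ^+ (n - i))).
  by rewrite !mulrA.
by rewrite -E exprS; ring.
Qed.

(** Variance of the binomial law with [n.+1] trials: the square is expanded into the moments [m1]
    and [m2]. *)
Lemma bernstein_var {R : realType} n (x : R) :
  \sum_(i < n.+2) (i%:R - n.+1%:R * x) ^+ 2 *
     ('C(n.+1, i)%:R * x ^+ i * (1 - x) ^+ (n.+1 - i)) =
  n.+1%:R * x * (1 - x).
Proof.
set w := fun i : nat => 'C(n.+1, i)%:R * x ^+ i * (1 - x) ^+ (n.+1 - i).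
have m1 : \sum_(i < n.+2) (i%:R * w i) = n.+1%:R * x.
  transitivity (\sum_(i < n.+2) (fun=> 1) (val i) * (i%:R * w i)).
    by apply: eq_bigr => i _; rewrite mul1r.
  rewrite (@sum_bin_shift _ n (fun=> 1) x (1 - x)).
  under eq_bigr do rewrite mul1r.
  by rewrite bernstein1 mulr1.
have m2 : \sum_(i < n.+2) (i%:R * (i%:R * w i)) =
    n.+1%:R * x * (n%:R * x + 1).
  rewrite (@sum_bin_shift _ n (fun i => i%:R) x (1 - x)); congr (_ * _).
  under eq_bigr do rewrite -natr1 mulrDl mul1r.
  rewrite big_split /= bernstein1; congr (_ + _).
  (* What remains is a first moment with [n] trials; the shift needs at least one trial. *)
  case: n {w m1} => [|n]; first by rewrite big_ord1 /= !mul0r.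
  transitivity (\sum_(i < n.+2) (fun=> 1) (val i) *
     (i%:R * ('C(n.+1, i)%:R * x ^+ i * (1 - x) ^+ (n.+1 - i)))).
    by apply: eq_bigr => i _; rewrite mul1r.
  rewrite (@sum_bin_shift _ n (fun=> 1) x (1 - x)).
  under eq_bigr do rewrite mul1r.
  by rewrite bernstein1 mulr1.
transitivity (\sum_(i < n.+2) (i%:R * (i%:R * w i))
   - (2 * n.+1%:R * x) * \sum_(i < n.+2) (i%:R * w i)
   + (n.+1%:R * x) ^+ 2 * \sum_(i < n.+2) w i).
  rewrite !mulr_sumr -sumrB -big_split /=; apply: eq_bigr => i _.
  by rewrite -/(w i); ring.
by rewrite m1 m2 /w bernstein1 -natr1; ring.
Qed.

Lemma bernstein_approx {R : realType} (g : R -> R) (L : R) : 0 < L ->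
  (forall x y, `|g x - g y| <= L * `|x - y|) ->
  forall e : R, 0 < e -> exists p : {poly R},
    forall x, 0 <= x <= 1 -> `|p.[x] - g x| <= e.
Proof.
move=> L0 gL e e0.
(* AM-GM: [|u| <= d + u^2 / d] with [d = e / (2 L)], [u = i / n - x] *)
pose d := e / (2 * L).
have d0 : 0 < d by rewrite divr_gt0// mulr_gt0.
have eE : e = L * d + L * d by rewrite /d; field; rewrite gt_eqF.
clearbody d.
(* With more than [1 / d^2] trials, the variance term [L * x (1 - x) / (d * n.+1)] is at most
   [L * d], the second half of [e]. *)
pose n := Num.trunc ((d * d)^-1).
have nN : (d * d)^-1 < n.+1%:R by rewrite truncnS_gt.
exists (bernstein g n.+1) => x /andP[x0 x1].
rewrite horner_bernstein.
set w := fun i : nat => 'C(n.+1, i)%:R * x ^+ i * (1 - x) ^+ (n.+1 - i).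
have w0 i : 0 <= w i.
  by rewrite /w !mulr_ge0// exprn_ge0// subr_ge0.
have N0 : 0 < n.+1%:R :> R by [].
have -> : g x = \sum_(i < n.+2) g x * w i by rewrite -mulr_sumr bernstein1 mulr1.
rewrite -sumrB; apply: le_trans (ler_norm_sum _ _ _) _.
have H (i : 'I_n.+2) : true ->
  `|g (i%:R / n.+1%:R) * w i - g x * w i| <=
  L * d * w i + L / (d * n.+1%:R ^+ 2) * ((i%:R - n.+1%:R * x) ^+ 2 * w i).
  move=> _; rewrite -mulrBl normrM (ger0_norm (w0 i)) [leRHS]
    (_ : _ = (L * d + L / (d * n.+1%:R ^+ 2) * (i%:R - n.+1%:R * x) ^+ 2) * w i); last by ring.
  apply: ler_wpM2r => //; apply: le_trans (gL _ _) _.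
  set u := i%:R / n.+1%:R - x.
  have -> : L * d + L / (d * n.+1%:R ^+ 2) * (i%:R - n.+1%:R * x) ^+ 2 =
      L * (d + `|u| ^+ 2 / d).
    rewrite real_normK ?num_real// /u; field.
    by rewrite !gt_eqF.
  rewrite ler_pM2l//.
  have [ud|/ltW du] := leP `|u| d.
    by rewrite (le_trans ud)// lerDl divr_ge0 ?exprn_ge0// ltW.
  apply: (@le_trans _ _ (`|u| ^+ 2 / d)); last by rewrite lerDr ltW.
  by rewrite ler_pdivlMr// expr2 ler_wpM2l.
apply: le_trans (ler_sum _ H) _.
rewrite big_split /= -!mulr_sumr bernstein1 bernstein_var mulr1.
rewrite eE lerD2l -mulrA ler_pM2l// mulrC.
have -> : n.+1%:R * x * (1 - x) / (d * n.+1%:R ^+ 2) = x * (1 - x) / (d * n.+1%:R).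
  by field; rewrite gt_eqF//= gt_eqF.
rewrite ler_pdivrMr ?mulr_gt0//.
have : 1 < n.+1%:R * (d * d).
  by move: nN; rewrite -div1r ltr_pdivrMr ?mulr_gt0.
have : x * (1 - x) <= 1 by nra.
by move: (n.+1%:R : R) => q; lra.
Qed.

Lemma weierstrass_lipschitz {R : realType} (g : R -> R) (L : R) : 0 < L ->
  (forall x y, `|g x - g y| <= L * `|x - y|) ->
  forall e : R, 0 < e -> exists p : {poly R},
    forall x, -1 <= x <= 1 -> `|p.[x] - g x| <= e.
Proof.
move=> L0 gL e e0.
have L20 : 0 < 2 * L by rewrite mulr_gt0.
have [x y|p Hp] := @bernstein_approx R (fun y => g (2 * y - 1)) _ L20 _ e e0.
  apply: le_trans (gL _ _) _.
  have -> : 2 * x - 1 - (2 * y - 1) = 2 * (x - y) by ring.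
  by rewrite normrM ger0_norm// mulrCA mulrA.
exists (p \Po (2^-1 *: ('X + 1))) => x /andP[x1 x2].
rewrite horner_comp !hornerE.
have := Hp (2^-1 * (x + 1)).
have -> : 2 * (2^-1 * (x + 1)) - 1 = x by field.
apply; apply/andP; split; lra.
Qed.

(** * Convergence of distribution functions from characteristic functions *)

(** For [u < v], a Lipschitz function lying between the indicators of []-oo, u]] and []-oo, v]]. *)
Definition ramp {R : realType} (u v y : R) : R := Num.min 1 (Num.max 0 ((v - y) / (v - u))).

Lemma ramp_lipschitz {R : realType} (u v : R) : u < v -> forall y z,
  `|ramp u v y - ramp u v z| <= (v - u)^-1 * `|y - z|.
Proof.
move=> uv y z.
have d0 : 0 < (v - u)^-1 by rewrite invr_gt0 subr_gt0.
rewrite -[X in X * `|y - z|]ger0_norm ?(ltW d0)// -normrM.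
have -> : `|(v - u)^-1 * (y - z)| = `|(v - y) / (v - u) - (v - z) / (v - u)|.
  by rewrite -normrN; congr (`| _ |); ring.
rewrite /ramp; move: ((v - y) / _) ((v - z) / _) => a b.
have := ler_norm (a - b); have := ler_norm (b - a); rewrite (distrC b a).
move: (`|a - b|) => r ba ab; apply/ler_normlP; rewrite /Num.max /Num.min /=.
by split; repeat case: ifPn; rewrite -?leNgt => *; lra.
Qed.

Lemma ramp_ge0 {R : realType} (u v y : R) : 0 <= ramp u v y.
Proof. by rewrite /ramp le_min ler01 le_max lexx. Qed.

Lemma ramp_le1 {R : realType} (u v y : R) : ramp u v y <= 1.
Proof. by rewrite /ramp ge_min lexx. Qed.

Lemma ramp1 {R : realType} (u v y : R) : u < v -> y <= u -> ramp u v y = 1.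
Proof.
move=> uv yu; rewrite /ramp min_l// le_max; apply/orP; right.
by rewrite ler_pdivlMr ?subr_gt0// mul1r lerB.
Qed.

Lemma ramp0 {R : realType} (u v y : R) : u < v -> v <= y -> ramp u v y = 0.
Proof.
move=> uv vy; rewrite /ramp max_l ?min_r//.
by rewrite pmulr_lle0 ?invr_gt0 ?subr_gt0// subr_le0.
Qed.

Lemma indic_itvNyc {R : realType} (t y : R) :
  \1_(`]-oo, t]%classic) y = (if y <= t then 1 else 0) :> R.
Proof.
rewrite indicE; case: ifPn => yt; first by rewrite mem_set//= in_itv.
by rewrite memNset//= in_itv/=; exact/negP.
Qed.

Section density_integral.
Context {R : realType}.
Notation mu := (@lebesgue_measure R).
Variable f : R -> R.
Hypothesis fi : mu.-integrable setT (EFin \o f).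

Lemma integrable_bounded_density (g : R -> R) (M : R) :
  measurable_fun setT g -> (forall x, `|g x| <= M) ->
  mu.-integrable setT (EFin \o (fun x => g x * f x)).
Proof.
move=> mg gM.
have mf : measurable_fun setT f by apply/measurable_EFinP; exact: measurable_int fi.
apply: (@le_integrable _ _ _ mu _ measurableT _ (EFin \o (fun x => M * f x))) => //.
- by apply/measurable_EFinP; exact: measurable_funM.
- move=> x _ /=; rewrite lee_fin !normrM ler_wpM2r//.
  by rewrite (le_trans (gM x))// ler_norm.
- have -> : EFin \o (fun x => M * f x) = (fun x => M%:E * (f x)%:E)%E.
    by apply/funext => x /=; rewrite EFinM.
  exact: integrableZl.
Qed.

End density_integral.

Section char_convergence.
Context {R : realType}.
Notation mu := (@lebesgue_measure R).
Variables (N : nat -> nat) (p x : nat -> nat -> R) (f : R -> R).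
Hypotheses (p0 : forall n i, 0 <= p n i)
  (p1 : forall n, \sum_(0 <= i < N n) p n i = 1)
  (x1 : forall n i, (i < N n)%N -> -1 <= x n i <= 1)
  (fi : mu.-integrable setT (EFin \o f)) (f0 : forall x, 0 <= f x)
  (f1 : \int[mu]_(x in setT) f x = 1)
  (fs : forall x : R, ~~ (-1 <= x <= 1) -> f x = 0).

Let expect n (g : R -> R) := \sum_(0 <= i < N n) p n i * g (x n i).
Let I (g : R -> R) := \int[mu]_(x in setT) (g x * f x).

(** Measurability and boundedness are carried along so that linear combinations can be integrated
    against [f]. *)
Let good (g : R -> R) :=
  [/\ measurable_fun setT g, exists M : R, forall x : R, `|g x| <= M &
      (fun n => expect n g) @ \oo --> I g].

Hypotheses (gcos : forall xi, (fun n => expect n (fun y => cos (xi * y))) @ \oo -->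
                 I (fun y => cos (xi * y)))
           (gsin : forall xi, (fun n => expect n (fun y => sin (xi * y))) @ \oo -->
                 I (fun y => sin (xi * y))).

Let int_good g : good g -> mu.-integrable setT (EFin \o (fun x => g x * f x)).
Proof. by case=> mg [M gM] _; exact: (integrable_bounded_density _ fi _ _ mg gM). Qed.

Let goodZD (a b : R) g h : good g -> good h -> good (fun y => a * g y + b * h y).
Proof.
move=> gg gh; have [ig ih] := (int_good _ gg, int_good _ gh).
move: gg gh => [mg [M gM] cg] [mh [K hK] ch]; split.
- by apply: measurable_funD; apply: measurable_funM.
- exists (`|a| * M + `|b| * K) => y.
  rewrite (le_trans (ler_normD _ _))// !normrM lerD// ler_wpM2l//.
have -> : I (fun y => a * g y + b * h y) = a * I g + b * I h.
  rewrite /I -!RintegralZl// -RintegralD//; last 2 first.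
  - have -> : EFin \o (fun x => a * (g x * f x)) = (fun x => a%:E * (g x * f x)%:E)%E.
      by apply/funext => y /=; rewrite EFinM.
    exact: integrableZl.
  - have -> : EFin \o (fun x => b * (h x * f x)) = (fun x => b%:E * (h x * f x)%:E)%E.
      by apply/funext => y /=; rewrite EFinM.
    exact: integrableZl.
  by apply: eq_Rintegral => y _; ring.
have -> : (fun n => expect n (fun y => a * g y + b * h y)) =
          (fun n => a * expect n g + b * expect n h).
  apply/funext => n; rewrite /expect !mulr_sumr -big_split /=.
  by apply: eq_bigr => i _; ring.
by apply: cvgD; apply: cvgMr.
Qed.

(** Product formulas trade a factor [sin (y / 2)] for frequencies [xi + 1/2] and [xi - 1/2] and
    exchange sine with cosine, so the induction on [m] keeps [xi] general and treats both together.
    Frequency 0 then yields the pure powers. *)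
Let good_trig m xi :
  good (fun y => sin (2^-1 * y) ^+ m * cos (xi * y)) /\
  good (fun y => sin (2^-1 * y) ^+ m * sin (xi * y)).
Proof.
have mc (g : R -> R) (r : R) : continuous g -> measurable_fun setT (fun y : R => g (r * y)).
  move=> cg; apply: continuous_measurable_fun => y.
  apply: (@continuous_comp _ _ _ (fun y : R => r * y) g); last exact: cg.
  by apply: cvgMr; exact: cvg_id.
elim: m xi => [|m IH] xi.
  split.
  - have -> : (fun y => sin (2^-1 * y) ^+ 0 * cos (xi * y)) = (fun y => cos (xi * y)).
      by apply/funext => y; rewrite expr0 mul1r.
    split; [by apply: mc; exact: continuous_cos|by exists 1 => y; exact: cos_max|exact: gcos].
  - have -> : (fun y => sin (2^-1 * y) ^+ 0 * sin (xi * y)) = (fun y => sin (xi * y)).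
      by apply/funext => y; rewrite expr0 mul1r.
    split; [by apply: mc; exact: continuous_sin|by exists 1 => y; exact: sin_max|exact: gsin].
have [cp sp] := IH (xi + 2^-1); have [cm sm] := IH (xi - 2^-1).
split.
- have -> : (fun y => sin (2^-1 * y) ^+ m.+1 * cos (xi * y)) =
     (fun y => 2^-1 * (sin (2^-1 * y) ^+ m * sin ((xi + 2^-1) * y)) +
               (- 2^-1) * (sin (2^-1 * y) ^+ m * sin ((xi - 2^-1) * y))).
    by apply/funext => y; rewrite mulrBl mulrDl sinB sinD exprS; field.
  exact: goodZD.
- have -> : (fun y => sin (2^-1 * y) ^+ m.+1 * sin (xi * y)) =
     (fun y => 2^-1 * (sin (2^-1 * y) ^+ m * cos ((xi - 2^-1) * y)) +
               (- 2^-1) * (sin (2^-1 * y) ^+ m * cos ((xi + 2^-1) * y))).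
    by apply/funext => y; rewrite mulrBl mulrDl cosB cosD exprS; field.
  exact: goodZD.
Qed.

Let good_poly (q : {poly R}) : good (fun y => q.[sin (2^-1 * y)]).
Proof.
have G : good (fun y => cos (0 * y)).
  have [+ _] := good_trig 0 0.
  by under eq_fun do rewrite expr0 mul1r.
have -> : (fun y => q.[sin (2^-1 * y)]) =
    (fun y => \sum_(i < size q) q`_i * sin (2^-1 * y) ^+ i).
  by apply/funext => y; rewrite horner_coef.
elim: (size q) => [|k IH].
  have -> : (fun y : R => \sum_(i < 0) q`_i * sin (2^-1 * y) ^+ i) =
      (fun y => 0 * cos (0 * y) + 0 * cos (0 * y)).
    by apply/funext => y; rewrite big_ord0 !mul0r addr0.
  exact: goodZD.
have -> : (fun y : R => \sum_(i < k.+1) q`_i * sin (2^-1 * y) ^+ i) =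
    (fun y => 1 * (\sum_(i < k) q`_i * sin (2^-1 * y) ^+ i)
       + q`_k * (sin (2^-1 * y) ^+ k * cos (0 * y))).
  by apply/funext => y; rewrite big_ord_recr /= mul0r cos0 mulr1 mul1r.
by apply: goodZD => //; have [] := good_trig k 0.
Qed.

Let cdfN n t := \sum_(0 <= i < N n) if x n i <= t then p n i else 0.
Let F t := \int[mu]_(x in `]-oo, t]) f x.

(** The range is [[-2, 2]] because thresholds up to distance 1 outside [[-1, 1]] will occur; the
    halves stay within [[- pi/2, pi/2]] since [1 <= pi/2]. *)
Let sin_half_lt (u v : R) : -2 <= u -> u < v -> v <= 2 -> sin (2^-1 * u) < sin (2^-1 * v).
Proof.
move=> u2 uv v2; rewrite ltr_sin ?ltr_pM2l//; have := @pihalf_ge1 R;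
 rewrite in_itv /= => ?; apply/andP; split; lra.
Qed.

Let sin_half_le (u v : R) : -2 <= u -> u <= v -> v <= 2 -> sin (2^-1 * u) <= sin (2^-1 * v).
Proof.
move=> u2; rewrite le_eqVlt => /orP[/eqP->//|uv] v2; exact/ltW/sin_half_lt.
Qed.

Let itvFE t : F t = \int[mu]_(x in setT) (\1_(`]-oo, t]%classic) x * f x).
Proof.
rewrite /F Rintegral_mkcond; apply: eq_Rintegral => y _.
by rewrite /patch indicE; case: ifPn => _; rewrite ?mul1r ?mul0r.
Qed.

(** A ramp in the variable [sin (y / 2)], between the images of [u] and [v], is replaced by a
    polynomial [q]. Three errors [e / 3] add up: [cdfN] against the expectation of [q], the
    convergence of that expectation, and its limit against [F]. *)
Let sandwich (u v e : R) : -2 <= u -> u < v -> v <= 2 -> 0 < e ->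
  (\forall n \near \oo, cdfN n u <= F v + e) /\
  (\forall n \near \oo, F u - e <= cdfN n v).
Proof.
move=> u2 uv v2 e0.
have suv := sin_half_lt _ _ u2 uv v2.
have L0 : 0 < (sin (2^-1 * v) - sin (2^-1 * u))^-1 by rewrite invr_gt0 subr_gt0.
have e30 : 0 < e / 3 by rewrite divr_gt0.
have [q Hq] := @weierstrass_lipschitz R _ _ L0 (@ramp_lipschitz R _ _ suv) _ e30.
have {}Hq y :
    `|q.[sin (2^-1 * y)] - ramp (sin (2^-1 * u)) (sin (2^-1 * v)) (sin (2^-1 * y))| <= e / 3.
  by apply: Hq; rewrite sin_geN1 sin_le1.
have up y : -1 <= y <= 1 -> q.[sin (2^-1 * y)] <= \1_(`]-oo, v]%classic) y + e / 3.
  move=> /andP[y1 y2]; have /ler_normlP[_] := Hq y.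
  have [yv|vy] := leP y v.
    rewrite indic_itvNyc yv.
    by have := ramp_le1 (sin (2^-1 * u)) (sin (2^-1 * v)) (sin (2^-1 * y)); lra.
  rewrite indic_itvNyc (leNgt y) vy /=.
  rewrite (@ramp0 R _ _ (sin (2^-1 * y)))//; first lra.
  apply: sin_half_le; lra.
have lo y : -1 <= y <= 1 -> \1_(`]-oo, u]%classic) y - e / 3 <= q.[sin (2^-1 * y)].
  move=> /andP[y1 y2]; have /ler_normlP[+ _] := Hq y.
  have [yv|vy] := leP y u.
    rewrite indic_itvNyc yv.
    rewrite (@ramp1 R _ _ (sin (2^-1 * y)))//; first lra.
    by apply: sin_half_le; lra.
  rewrite indic_itvNyc (leNgt y) vy /=.
  by have := ramp_ge0 (sin (2^-1 * u)) (sin (2^-1 * v)) (sin (2^-1 * y)); lra.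
have gq := good_poly q.
have iq := int_good _ gq.
have iI t c : mu.-integrable setT (EFin \o (fun y => (\1_(`]-oo, t]%classic) y + c) * f y)).
  apply: (@integrable_bounded_density _ _ fi _ (1 + `|c|)).
    by apply: measurable_funD => //; exact: measurable_indic.
  move=> y; rewrite (le_trans (ler_normD _ _))// lerD2r indicE.
  by case: (_ \in _); rewrite ?normr1 ?normr0.
have II t c : \int[mu]_(y in setT) ((\1_(`]-oo, t]%classic) y + c) * f y) = F t + c.
  rewrite itvFE; transitivity (\int[mu]_(y in setT) (\1_(`]-oo, t]%classic) y * f y) +
     \int[mu]_(y in setT) (c * f y)); last by rewrite RintegralZl// f1 mulr1.
  rewrite -RintegralD//.
  - by apply: eq_Rintegral => y _; ring.
  - have := iI t 0; congr (mu.-integrable _ _).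
    by apply/funext => y /=; rewrite addr0.
  - apply: (@integrable_bounded_density _ _ fi (cst c) `|c|) => //.
have upI : I (fun y => q.[sin (2^-1 * y)]) <= F v + e / 3.
  rewrite -II; apply: le_Rintegral => // y _.
  (* The comparison [up] rests on the monotonicity of [sin (y / 2)] and holds only on [[-1, 1]];
     elsewhere [f] vanishes. *)
  have [y1|y1] := boolP (-1 <= y <= 1); last by rewrite fs// !mulr0.
  by rewrite ler_wpM2r// up.
have loI : F u - e / 3 <= I (fun y => q.[sin (2^-1 * y)]).
  rewrite -II; apply: le_Rintegral => // y _.
  have [y1|y1] := boolP (-1 <= y <= 1); last by rewrite fs// !mulr0.
  by rewrite ler_wpM2r// lo.
have [_ _ /cvgrPdist_le /(_ _ e30)] := gq.
move=> ne.
have expc n : \sum_(0 <= i < N n) p n i * (e / 3) = e / 3.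
  by rewrite -mulr_suml p1 mul1r.
split; near=> n.
- have : `|I (fun y => q.[sin (2^-1 * y)]) - expect n (fun y => q.[sin (2^-1 * y)])| <= e / 3.
    by near: n.
  suff : cdfN n u <= expect n (fun y => q.[sin (2^-1 * y)]) + e / 3.
    by move=> ? /ler_normlP[? ?]; lra.
  rewrite -[e / 3](expc n) /cdfN /expect -big_split /= !big_nat.
  apply: ler_sum => i /andP[_ iN].
  rewrite -mulrDr; have := lo _ (x1 _ _ iN); rewrite indic_itvNyc.
  case: ifPn => xu H.
    rewrite -[leLHS]mulr1 ler_wpM2l//; lra.
  by rewrite mulr_ge0//; lra.
- have : `|I (fun y => q.[sin (2^-1 * y)]) - expect n (fun y => q.[sin (2^-1 * y)])| <= e / 3.
    by near: n.
  suff : expect n (fun y => q.[sin (2^-1 * y)]) <= cdfN n v + e / 3.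
    by move=> ? /ler_normlP[? ?]; lra.
  rewrite -[e / 3](expc n) /cdfN /expect -big_split /= !big_nat.
  apply: ler_sum => i /andP[_ iN].
  have := up _ (x1 _ _ iN); rewrite indic_itvNyc.
  case: ifPn => xu H.
    by rewrite -[X in X + _]mulr1 -mulrDr ler_wpM2l.
  by rewrite add0r ler_wpM2l//; lra.
Unshelve. all: by end_near. Qed.

(** Continuity of [F]: the second hypothesis is absolute continuity of the integral of [f], applied
    to the short interval []u, v]]. *)
Let F_mono_le (u v d : R) e : u <= v -> 
  (forall A, measurable A -> (mu A < d%:E)%E -> \int[mu]_(x in A) `|f x| < e) ->
  v - u < d -> F v <= F u + e.
Proof.
move=> uv Hd vd.
have -> : F v = F u + \int[mu]_(y in `]u, v]) f y.
  have := @Rintegral_itvB R f -oo%O (BRight v) u.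
  move=> <-//; first by rewrite addrC subrK.
  exact: integrableS fi.
rewrite lerD2l ltW//; apply: le_lt_trans (Hd `]u, v]%classic _ _) => //.
- apply: le_trans (ler_norm _) _; apply: (@le_normr_Rintegral _ _ _ mu) => //.
  exact: integrableS fi.
- by rewrite lebesgue_measure_itv /=; case: ifPn => _; rewrite ?lte_fin //;
   apply: le_lt_trans vd; rewrite subr_ge0.
Qed.

Theorem cvg_cdf_of_char t : (fun n => cdfN n t) @ \oo --> F t.
Proof.
have [t1|t1] := ltP t (-1).
  have -> : F t = 0.
    rewrite itvFE (_ : 0 = \int[mu]_(y in setT) (0 * f y)); last first.
      by rewrite RintegralZl// mul0r.
    apply: eq_Rintegral => y _; rewrite mul0r indic_itvNyc.
    case: ifPn; rewrite ?mul0r// => yt.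
    rewrite fs ?mulr0//; apply/negP => /andP[]; lra.
  rewrite (_ : (fun n => cdfN n t) = cst 0); first exact: cvg_cst.
  apply/funext => n; rewrite /cdfN big_nat big1// => i /andP[_ iN].
  by have /andP[? _] := x1 _ _ iN; case: ifPn => // ?; lra.
have [t2|t2] := leP 1 t.
  have -> : F t = 1.
    rewrite -f1 itvFE; apply: eq_Rintegral => y _; rewrite indic_itvNyc.
    case: ifPn; rewrite ?mul1r// -ltNge => yt.
    rewrite fs ?mulr0//; apply/negP => /andP[]; lra.
  rewrite (_ : (fun n => cdfN n t) = cst 1); first exact: cvg_cst.
  apply/funext => n; rewrite -[RHS](p1 n) /cdfN !big_nat.
  apply: eq_bigr => i /andP[_ iN].
  by have /andP[_ ?] := x1 _ _ iN; case: ifPn => //; lra.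
apply/cvgrPdist_le => e e0.
have e20 : 0 < e / 2 by rewrite divr_gt0.
have [d [d0 Hd]] := integral_normr_continuous fi e20.
(* [c <= 1] keeps [t - c] and [t + c] in [[-2, 2]] for [sandwich]; [c < d] bounds the increments of
   [F] by [e / 2]. *)
pose c := Num.min 1 (d / 2).
have c0 : 0 < c by rewrite /c lt_min ltr01 divr_gt0.
have c1 : c <= 1 by rewrite /c ge_min lexx.
have cd : c < d by rewrite /c gt_min; apply/orP; right; lra.
have [A _] := sandwich t (t + c) (e / 2) ltac:(lra) ltac:(lra) ltac:(lra) e20.
have [_ B] := sandwich (t - c) t (e / 2) ltac:(lra) ltac:(lra) ltac:(lra) e20.
have HA : F (t + c) <= F t + e / 2 by apply: (@F_mono_le _ _ d) => //; lra.
have HB : F t <= F (t - c) + e / 2 by apply: (@F_mono_le _ _ d) => //; lra.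
near=> n.
have a : cdfN n t <= F (t + c) + e / 2 by near: n.
have b : F (t - c) - e / 2 <= cdfN n t by near: n.
by apply/ler_normlP; split; lra.
Unshelve. all: by end_near. Qed.

End char_convergence.

(** * The group velocity *)

(** The announced density with [|a|] and [lambda] replaced by free real parameters. At these values
    it is convertible to [qw_density], so its analysis is purely real. *)
Definition konno_density {R : realType} (r l x : R) : R :=
  if `|x| < r then
    Num.sqrt (1 - r ^+ 2) / (pi * (1 - x ^+ 2) * Num.sqrt (r ^+ 2 - x ^+ 2)) * (1 - l * x)
  else 0.

(* [sin_phase r] and [group_speed r] are the sine and the derivative of the phase
   [acos (r * cos th)] of the eigenvalues of the walk at frequency [th]. *)
Definition sin_phase {R : realType} (r th : R) : R := Num.sqrt (1 - (r * cos th) ^+ 2).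
Definition group_speed {R : realType} (r th : R) : R := r * sin th / sin_phase r th.

Lemma is_derive_continuous {R : realType} (f : R -> R) (x d : R) :
  is_derive x 1 f d -> {for x, continuous f}.
Proof. by move=> [df _]; exact/differentiable_continuous/derivable1_diffP. Qed.

Lemma Rintegral_is_derive {R : realType} (h A : R -> R) (a b : R) : a < b ->
  continuous h -> (forall x : R, is_derive x 1 A (h x)) ->
  \int[lebesgue_measure]_(x in `[a, b]) h x = A b - A a.
Proof.
move=> ab ch dA; rewrite /Rintegral (@continuous_FTC2 R h A)//.
- exact: continuous_subspaceT.
- split=> [x _| |]; first by have [] := dA x.
  + exact/cvg_at_right_filter/(is_derive_continuous _ _ _ (dA _)).
  + exact/cvg_at_left_filter/(is_derive_continuous _ _ _ (dA _)).
- by move=> x _; rewrite derive1E; have H := dA x; rewrite derive_val.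
Qed.

Lemma integral_odd {R : realType} (h : R -> R) (c : R) : 0 <= c ->
  continuous h -> (forall x, h (- x) = - h x) ->
  \int[lebesgue_measure]_(x in `[- c, c]) h x = 0.
Proof.
have zN (z : R) : z = - z -> z = 0 by lra.
move=> c0 ch odd; have wch A : {within A, continuous h} by exact: continuous_subspaceT.
have ih : lebesgue_measure.-integrable `[- c, c] (EFin \o h).
  by apply: continuous_compact_integrable; [exact: segment_compact|exact: wch].
have E : \int[lebesgue_measure]_(x in `[- c, c]) h x =
         \int[lebesgue_measure]_(x in `[- c, c]) (- h x).
  rewrite {1}/Rintegral; have := @integration_by_substitution_oppr R h (- c) c.
  rewrite opprK => -> //; last by rewrite (le_trans _ c0)// oppr_le0.
  by congr fine; apply: eq_integral => x _ /=; rewrite odd.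
have N : \int[lebesgue_measure]_(x in `[- c, c]) (- h x) =
   - \int[lebesgue_measure]_(x in `[- c, c]) h x.
  rewrite -[RHS]mulN1r -RintegralZl//; apply: eq_Rintegral => x _.
  by rewrite mulN1r.
exact: zN (etrans E N).
Qed.

Section group_speed.
Context {R : realType}.
Variables (r : R).
Hypotheses (r0 : 0 < r) (r1 : r < 1).
Notation mu := (@lebesgue_measure R).
Notation S := (sin_phase r).
Notation v := (group_speed r).
Notation s := (Num.sqrt (1 - r ^+ 2)).

Lemma sin_phase_arg_gt0 (th : R) : 0 < 1 - (r * cos th) ^+ 2.
Proof.
have : cos th ^+ 2 <= 1 by rewrite cos2sin2 gerBl sqr_ge0.
have : r ^+ 2 < 1 by rewrite expr_lt1// ltW.
by have := sqr_ge0 (cos th); have := sqr_ge0 r; rewrite exprMn; nra.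
Qed.

Lemma sin_phase_gt0 th : 0 < S th.
Proof. by rewrite sqrtr_gt0 sin_phase_arg_gt0. Qed.

Lemma sin_phase_neq0 th : S th != 0.
Proof. by rewrite gt_eqF// sin_phase_gt0. Qed.

Lemma sqr_sin_phase th : S th ^+ 2 = 1 - (r * cos th) ^+ 2.
Proof. by rewrite sqr_sqrtr// ltW// sin_phase_arg_gt0. Qed.

Lemma sin_coin_gt0 : 0 < s.
Proof. by rewrite sqrtr_gt0 subr_gt0 expr_lt1// ltW. Qed.

Lemma sqr_sin_coin : s ^+ 2 = 1 - r ^+ 2.
Proof. by rewrite sqr_sqrtr// subr_ge0 expr_le1// ltW. Qed.

Lemma is_derive_sin_phase (th : R) :
  is_derive th 1 S (r ^+ 2 * cos th * sin th / S th).
Proof.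
have H := is_derive1_sqrt (sin_phase_arg_gt0 th).
have E : is_derive th 1 (fun y => 1 - (r * cos y) ^+ 2) (2 * r ^+ 2 * cos th * sin th).
  have -> : (fun y => 1 - (r * cos y) ^+ 2) = cst 1 - (cst r * cos) ^+ 2.
    by apply/funext.
  by apply: is_derive_eq; rewrite ?fctE /cst /= /GRing.scale /=; ring.
have := @is_derive1_comp R Num.sqrt (fun y => 1 - (r * cos y) ^+ 2) th _ _ H E.
rewrite (_ : _ / S th = (2 * S th)^-1 * (2 * r ^+ 2 * cos th * sin th)) //.
by field; exact: sin_phase_neq0.
Qed.

Lemma is_derive_group_speed (th : R) :
  is_derive th 1 v (r * cos th * s ^+ 2 / S th ^+ 3).
Proof.
have H := is_derive_sin_phase th.
have HV := is_deriveV (sin_phase_neq0 th) H.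
have -> : v = (cst r * sin) * (fun y => (S y)^-1) by apply/funext.
apply: is_derive_eq.
rewrite ?fctE /cst /= /GRing.scale /= sqr_sin_coin.
have := sqr_sin_phase th; have := cos2Dsin2 th; have := sin_phase_neq0 th.
move: (S th) (cos th) (sin th) => S' c d nz cd SE.
apply: (mulIf (expf_neq0 3 nz)).
rewrite divfK ?expf_neq0//.
transitivity (r * c * S' ^+ 2 - r ^+ 3 * c * d ^+ 2); first by field.
have -> : d ^+ 2 = 1 - c ^+ 2 by rewrite -cd; ring.
by rewrite SE; ring.
Qed.

Lemma continuous_sin_phase : continuous S.
Proof. move=> th; exact: is_derive_continuous (is_derive_sin_phase th). Qed.

Lemma continuous_group_speed : continuous v.
Proof. move=> th; exact: is_derive_continuous (is_derive_group_speed th). Qed.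

Lemma group_speedN th : v (- th) = - v th.
Proof. by rewrite /group_speed /sin_phase cosN sinN mulrN mulNr. Qed.

(** Because [S^2 - (r sin th)^2 = 1 - r^2]. In this form the factor [1 - x^2] of the density becomes
    [(s / S)^2] at [x = v]. *)
Lemma group_speed_sqr th : v th ^+ 2 = 1 - s ^+ 2 / S th ^+ 2.
Proof.
rewrite /group_speed exprMn exprVn exprMn sin2cos2 sqr_sin_coin.
have := sqr_sin_phase th; have := sin_phase_neq0 th.
move: (S th) (cos th) => S' c nz SE.
apply: (mulIf (expf_neq0 2 nz)); rewrite divfK ?expf_neq0//.
by rewrite mulrBl divfK ?expf_neq0// SE; ring.
Qed.

Lemma group_speed_bound th : `|v th| <= r.
Proof.
rewrite -(@ler_pXn2r _ 2) ?nnegrE ?(ltW r0)// real_normK ?num_real//.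
rewrite group_speed_sqr lerBlDr -lerBlDl -[leLHS]sqr_sin_coin.
rewrite ler_pdivlMr ?exprn_gt0 ?sin_phase_gt0// ler_piMr ?sqr_ge0//.
by rewrite sqr_sin_phase gerBl sqr_ge0.
Qed.

Lemma group_speed_pihalf : v (pi / 2) = r.
Proof.
rewrite /group_speed /sin_phase cos_pihalf sin_pihalf.
by rewrite mulr0 expr0n subr0 sqrtr1 divr1 mulr1.
Qed.

Lemma group_speed_lt : {in `[- (pi / 2), pi / 2] &, {homo v : x y / x < y}}.
Proof.
apply: gtr0_derive1_lt_cc.
- by move=> x _; have [] := is_derive_group_speed x.
- move=> x; rewrite in_itv /= => /cos_gt0_pihalf c0.
  have H := is_derive_group_speed x; rewrite derive1E derive_val.
  by rewrite divr_gt0 ?exprn_gt0 ?sin_phase_gt0// !mulr_gt0// ?exprn_gt0 ?sin_coin_gt0.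
- exact/continuous_subspaceT/continuous_group_speed.
Qed.

Lemma group_speed_surj x : `|x| < r -> exists2 th, - (pi / 2) < th < pi / 2 & v th = x.
Proof.
rewrite ltr_norml => /andP[x1 x2].
have pi0 : 0 < pi / 2 :> R by rewrite divr_gt0 ?pi_gt0.
have pile : - (pi / 2) <= pi / 2 :> R by lra.
have xv : Num.min (v (- (pi / 2))) (v (pi / 2)) <= x <=
    Num.max (v (- (pi / 2))) (v (pi / 2)).
  rewrite group_speedN group_speed_pihalf.
  by rewrite min_l ?max_r; [rewrite !ltW|lra|lra].
have [th thi vth] := @IVT R v (- (pi / 2)) (pi / 2) x pile
    (continuous_subspaceT continuous_group_speed) xv.
exists th => //; move: thi; rewrite in_itv /= => /andP[t1 t2].
rewrite !lt_neqAle t1 t2 !andbT; apply/andP; split; apply/eqP => E; move: vth.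
- by rewrite -E group_speedN group_speed_pihalf => E'; move: x1; rewrite E' ltxx.
- by rewrite E group_speed_pihalf => E'; move: x2; rewrite E' ltxx.
Qed.

(** As [v^2 = 1 - s^2 / S^2], this amounts to the integral of [s / (sin^2 + s^2 cos^2)] being [pi].
    Both moments of the limit reduce to it. *)
Lemma integral_group_speed_sqr :
  \int[mu]_(th in `[- (pi / 2), pi / 2]) v th ^+ 2 = pi * (1 - s).
Proof.
pose q th : R := s * cos th ^+ 2 + sin th ^+ 2.
have s0 := sin_coin_gt0.
have s1 : s <= 1.
  by rewrite -[leRHS]sqrtr1 ler_sqrt// gerBl sqr_ge0.
have q0 th : 0 < q th.
  have : cos th ^+ 2 + sin th ^+ 2 = 1 := cos2Dsin2 th.
  by rewrite /q; have := sqr_ge0 (cos th); have := sqr_ge0 (sin th); nra.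
(* [atan ((1 - s) sin cos / q)] is [atan (tan / s) - id], but is regular at [+-pi/2] *)
pose A th : R := th - s * (th + atan ((1 - s) * sin th * cos th / q th)).
have dA (th : R) : is_derive th 1 A (v th ^+ 2).
  have dq : is_derive th 1 q (2 * (1 - s) * sin th * cos th).
    have -> : q = cst s * cos ^+ 2 + sin ^+ 2 by apply/funext.
    by apply: is_derive_eq; rewrite ?fctE /cst /= /GRing.scale /=; ring.
  have dV := is_deriveV (lt0r_neq0 (q0 th)) dq.
  have da : is_derive th 1 (fun y => (1 - s) * sin y * cos y / q y)
     ((1 - s) * (s * cos th ^+ 2 - sin th ^+ 2) / q th ^+ 2).
    have -> : (fun y => (1 - s) * sin y * cos y / q y) =
       (cst (1 - s) * sin * cos) * (fun y => (q y)^-1) by apply/funext.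
    apply: is_derive_eq; rewrite ?fctE /cst /= /GRing.scale /=.
    have := lt0r_neq0 (q0 th); rewrite /q => qn.
    have cd := cos2Dsin2 th; move: qn cd; move: (cos th) (sin th) => c d qn cd.
    have E : (1 - s) * (s * c ^+ 2 - d ^+ 2) =
      (1 - s) * (s * c ^+ 2 - d ^+ 2) * (c ^+ 2 + d ^+ 2) by rewrite cd mulr1.
    by rewrite E; field.
  have dat := @is_derive1_comp R atan (fun y => (1 - s) * sin y * cos y / q y) th _ _
    (is_derive1_atan _) da.
  have -> : A = id - cst s * (id + (atan \o (fun y => (1 - s) * sin y * cos y / q y))).
    by apply/funext.
  apply: is_derive_eq; rewrite ?fctE /cst /= /GRing.scale /= group_speed_sqr.
  rewrite sqr_sin_phase (_ : (r * cos th) ^+ 2 = r ^+ 2 * cos th ^+ 2); last exact: exprMn.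
  have S0 := lt0r_neq0 (sin_phase_arg_gt0 th); rewrite exprMn in S0.
  have Q0 := lt0r_neq0 (q0 th).
  have N0 : 1 + ((1 - s) * sin th * cos th / q th) ^+ 2 != 0.
    by rewrite lt0r_neq0// ltr_pwDl// sqr_ge0.
  move: S0 Q0 N0 (cos2Dsin2 th) sqr_sin_coin; rewrite /q.
  move: (cos th) (sin th) s => c d t n2 n3 n1 cd tE.
  have rE : r ^+ 2 = 1 - t ^+ 2 by rewrite tE; ring.
  rewrite rE in n2 *.
  have dE : d ^+ 2 = 1 - c ^+ 2 by rewrite -cd; ring.
  have SE : 1 - (1 - t ^+ 2) * c ^+ 2 = d ^+ 2 + t ^+ 2 * c ^+ 2 by rewrite dE; ring.
  rewrite SE in n2 *.
  (* The derivative of [atan] produces this sum of squares as denominator; homogenised by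
     [cos^2 + sin^2 = 1], it is just [S^2]. *)
  have n4 : (t * c ^+ 2 + d ^+ 2) ^+ 2 + ((1 - t) * d * c) ^+ 2 = d ^+ 2 + t ^+ 2 * c ^+ 2.
    transitivity ((d ^+ 2 + t ^+ 2 * c ^+ 2) * (c ^+ 2 + d ^+ 2)); first by ring.
    by rewrite cd mulr1.
  have -> : 1 + ((1 - t) * d * c / (t * c ^+ 2 + d ^+ 2)) ^+ 2 =
      (d ^+ 2 + t ^+ 2 * c ^+ 2) / (t * c ^+ 2 + d ^+ 2) ^+ 2.
    by rewrite -n4; field.
  have -> : (1 - t) * (t * c ^+ 2 - d ^+ 2) / (t * c ^+ 2 + d ^+ 2) ^+ 2 =
     (t - (d ^+ 2 + t ^+ 2 * c ^+ 2)) / (t * c ^+ 2 + d ^+ 2) ^+ 2.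
    have -> : t - (d ^+ 2 + t ^+ 2 * c ^+ 2) = t * (c ^+ 2 + d ^+ 2) - (d ^+ 2 + t ^+ 2 * c ^+ 2).
      by rewrite cd mulr1.
    by congr (_ / _); ring.
  by field; rewrite exprMn n2 n3.
have pi0 : 0 < pi / 2 :> R by rewrite divr_gt0 ?pi_gt0.
rewrite (@Rintegral_is_derive R (fun th => v th ^+ 2) A) //; first 1 last.
- lra.
- move=> th; under eq_fun do rewrite expr2.
  by apply: continuousM; exact: continuous_group_speed.
by rewrite /= /A cosN cos_pihalf !mulr0 !mul0r atan0; field.
Qed.

End group_speed.

(** * The limit density as an image of the uniform law *)

Section konno_density.
Context {R : realType}.
Variables (r l : R).
Hypotheses (r0 : 0 < r) (r1 : r < 1) (lr : `|l| * r <= 1).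
Notation mu := (@lebesgue_measure R).
Notation S := (sin_phase r).
Notation v := (group_speed r).
Notation s := (Num.sqrt (1 - r ^+ 2)).
Notation f := (konno_density r l).

Let G (x : R) : R := s / (pi * (1 - x ^+ 2) * Num.sqrt (r ^+ 2 - x ^+ 2)) * (1 - l * x).

Lemma tilt_ge0 (x : R) : `|x| <= r -> 0 <= 1 - l * x.
Proof.
move=> xr; rewrite subr_ge0 (le_trans (ler_norm _))// normrM.
by rewrite (le_trans _ lr)// ler_wpM2l.
Qed.

Let xr_sqr (x : R) : `|x| < r -> 0 < r ^+ 2 - x ^+ 2 /\ 0 < 1 - x ^+ 2.
Proof.
move=> xr; have : x ^+ 2 < r ^+ 2.
  by rewrite -(real_normK (num_real x)) ltr_pXn2r// nnegrE// ltW.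
have : r ^+ 2 < 1 by rewrite expr_lt1// ltW.
by lra.
Qed.

Let G_ge0 (x : R) : `|x| < r -> 0 <= G x.
Proof.
move=> xr; have [h1 h2] := xr_sqr _ xr.
rewrite /G mulr_ge0//; last exact/tilt_ge0/ltW.
by rewrite divr_ge0 ?sqrtr_ge0// !mulr_ge0 ?pi_ge0 ?sqrtr_ge0// ltW.
Qed.

Lemma konno_density_ge0 (x : R) : 0 <= f x.
Proof. by rewrite /konno_density; case: ifPn => // /G_ge0. Qed.

Lemma konno_density_out (x : R) : ~~ (-1 <= x <= 1) -> f x = 0.
Proof.
have rlt1 := r1; move=> x1; rewrite /konno_density; case: ifPn => //.
rewrite ltr_norml => /andP[? ?]; move: x1; rewrite negb_and -!ltNge => /orP[?|?]; lra.
Qed.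

Let continuous_G (x : R) : `|x| < r -> {for x, continuous G}.
Proof.
move=> xr; have [h1 h2] := xr_sqr _ xr.
have cX (c : R) : {for x, continuous (fun y : R => c - y ^+ 2)}.
  apply: (@continuousB _ _ _ (cst c) (fun y : R => y ^+ 2)); first exact: cvg_cst.
  exact: exprn_continuous.
apply: continuousM; last first.
  by apply: cvgB; [exact: cvg_cst|apply: cvgMr; exact: cvg_id].
apply: continuousM; first exact: cvg_cst.
apply: continuousV.
  by rewrite !mulf_neq0 ?gt_eqF ?pi_gt0 ?sqrtr_gt0.
apply: continuousM.
  by apply: continuousM; [exact: cvg_cst|exact: cX].
apply: (@continuous_comp _ _ _ (fun y : R => r ^+ 2 - y ^+ 2) Num.sqrt); first exact: cX.
exact: sqrt_continuous.
Qed.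

Let konno_densityE : f = G \_ `]- r, r[.
Proof.
apply/funext => x; rewrite /patch /konno_density ltr_norml.
case: ifPn => xr; first by rewrite mem_set//= in_itv.
by rewrite memNset//= in_itv/=; exact/negP.
Qed.

Lemma measurable_konno_density : measurable_fun setT f.
Proof.
rewrite konno_densityE; apply/measurable_restrict => //.
rewrite setTI; apply: open_continuous_measurable_fun; first exact: interval_open.
by move=> x; rewrite inE /= in_itv /= -ltr_norml => /continuous_G.
Qed.

(** Jacobian identity of [x = v(th)]: with [1 - v^2 = (s / S)^2] and
    [r^2 - v^2 = (r s cos th / S)^2], all cancels but [1 / pi] and the tilt [1 - l v]. The sign of
    [cos th] resolves the square root. *)
Let G_group_speed (th : R) : 0 < cos th ->
  G (v th) * (r * cos th * s ^+ 2 / S th ^+ 3) = pi^-1 * (1 - l * v th).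
Proof.
move=> c0; rewrite /G.
have S0 := sin_phase_gt0 _ r0 r1 th; have s0 := sin_coin_gt0 _ r0 r1.
have -> : Num.sqrt (r ^+ 2 - v th ^+ 2) = r * s * cos th / S th.
  rewrite -[RHS]ger0_norm ?divr_ge0 ?mulr_ge0 ?(ltW r0) ?(ltW s0) ?(ltW c0) ?(ltW S0)//.
  rewrite -sqrtr_sqr; congr Num.sqrt.
  rewrite (group_speed_sqr _ r0 r1) exprMn exprVn.
  have SE := sqr_sin_phase _ r0 r1 th; have sE := sqr_sin_coin _ r0 r1.
  have SN : S th ^+ 2 != 0 by rewrite expf_neq0// gt_eqF.
  apply: (mulIf SN); rewrite divfK// mulrBl mulrBl divfK// SE.
  by rewrite !exprMn sE; ring.
rewrite (group_speed_sqr _ r0 r1) subKr.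
move: (v th) => w; move: (S th) (cos th) s S0 c0 s0 => S' c t S0 c0 t0.
move: (@pi R) (pi_gt0 R) => p pi0.
by field; rewrite (gt_eqF pi0) (gt_eqF c0) (gt_eqF r0) (gt_eqF t0) (gt_eqF S0).
Qed.

Let derive_group_speed : derive1 v = (fun th => r * cos th * s ^+ 2 / S th ^+ 3).
Proof.
apply/funext => th; have H := is_derive_group_speed _ r0 r1 th.
by rewrite derive1E derive_val.
Qed.

Let continuous_derive_group_speed : continuous (derive1 v).
Proof.
rewrite derive_group_speed.
suff c : continuous (fun th : R => (r * cos th * s ^+ 2 / S th ^+ 3 : R)) by [].
move=> th; apply: cvgM.
  apply: cvgM; last exact: cvg_cst.
  by apply: cvgMr; exact: continuous_cos.
apply: cvgV.
  by rewrite expf_neq0// gt_eqF// sin_phase_gt0.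
apply: (@continuous_comp _ _ _ S (fun y : R => y ^+ 3)).
  exact: continuous_sin_phase.
exact: exprn_continuous.
Qed.

Variable g : R -> R.
Hypothesis cg : continuous g.

Let pull (th : R) : R := pi^-1 * (g (v th) * (1 - l * v th)).

Lemma continuous_pull : continuous pull.
Proof.
have cv := continuous_group_speed _ r0 r1.
move=> th; apply: cvgM; first exact: cvg_cst.
apply: cvgM.
  apply: (@continuous_comp _ _ _ v g); [exact: cv|exact: cg].
by apply: cvgB; [exact: cvg_cst|apply: cvgMr; exact: cv].
Qed.

(** Stopping before [pi / 2] keeps the image of [v] strictly inside []-r, r[], where [G] is
    continuous. *)
Let integral_subst (c : R) : 0 < c -> c < pi / 2 ->
  (\int[mu]_(x in `[v (- c)%R, v c]) (g x * G x)%R%:E =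
   \int[mu]_(th in `[(- c)%R, c]) (pull th)%:E)%E.
Proof.
move=> c0 cpi.
have cv := continuous_group_speed _ r0 r1.
have sub (x : R) : x \in `[- c, c] -> x \in `[- (pi / 2), pi / 2].
  by rewrite !in_itv /= => /andP[? ?]; apply/andP; split; lra.
have vlt : {in `[- c, c] &, {homo v : x y / x < y}}.
  by move=> x y xc yc; apply: (group_speed_lt _ r0 r1); exact: sub.
rewrite (@integration_by_substitution_increasing R v (fun x => g x * G x)) //.
- apply: eq_integral => x; rewrite inE => xc; congr (_%:E).
  have dE : derive1 v x = r * cos x * s ^+ 2 / S x ^+ 3 by rewrite derive_group_speed.
  transitivity (g (v x) * G (v x) * derive1 v x); first by [].
  rewrite dE -mulrA G_group_speed; first by rewrite /pull mulrCA.
  by apply: cos_gt0_pihalf; move: xc; rewrite /= in_itv /= => /andP[? ?]; lra.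
- lra.
- apply/cvg_ex; exists (derive1 v (- c)).
  exact/cvg_at_right_filter/continuous_derive_group_speed.
- apply/cvg_ex; exists (derive1 v c).
  exact/cvg_at_left_filter/continuous_derive_group_speed.
- split=> [x _| |]; first by have [] := is_derive_group_speed _ r0 r1 x.
  + exact/cvg_at_right_filter/cv.
  + exact/cvg_at_left_filter/cv.
- apply: continuous_in_subspaceT => x; rewrite inE /= in_itv /= => /andP[x1 x2].
  apply: continuousM; first exact: cg.
  apply: continuous_G.
  have vc : v c < r.
    rewrite -[X in _ < X](group_speed_pihalf r).
    by apply: (group_speed_lt _ r0 r1) => //; rewrite in_itv /=; apply/andP; split; lra.
  by rewrite ltr_norml; move: x1; rewrite group_speedN; lra.
Qed.

(** The offset 2 makes [bnd 0] positive already, since [1 <= pi / 2]. *)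
Let bnd n : R := pi / 2 - n.+2%:R^-1.

Let bnd_gt0 n : 0 < bnd n.
Proof.
have := @pihalf_ge1 R; rewrite /bnd subr_gt0; apply: lt_le_trans.
by rewrite invf_lt1// ltr1n.
Qed.

Let bnd_lt n : bnd n < pi / 2.
Proof. by rewrite /bnd gtrBl invr_gt0. Qed.

Let bnd_nd : {homo bnd : m n / (m <= n)%N >-> m <= n}.
Proof. by move=> m n mn; rewrite /bnd lerB// lef_pV2 ?posrE// ler_nat. Qed.

Let bnd_ex (th : R) : `|th| < pi / 2 -> exists n, `|th| <= bnd n.
Proof.
move=> thpi; pose d := pi / 2 - `|th|; have d0 : 0 < d by rewrite subr_gt0.
exists (Num.trunc d^-1); rewrite /bnd lerBrDl -lerBrDr.
rewrite invf_ple ?posrE//; apply: ltW; apply: lt_trans (_ : (Num.trunc d^-1).+1%:R < _).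
  exact: truncnS_gt.
by rewrite ltr_nat.
Qed.

Let union_th : \bigcup_n `[- bnd n, bnd n]%classic = `]- (pi / 2), pi / 2[%classic.
Proof.
apply/seteqP; split=> th /=.
  move=> [n _] /=; rewrite !in_itv /= => /andP[? ?]; have := bnd_lt n.
  by move=> ?; apply/andP; split; lra.
rewrite in_itv /= -ltr_norml => /bnd_ex[n hn]; exists n => //=.
by rewrite in_itv /= -ler_norml.
Qed.

Let union_x : \bigcup_n `[v (- bnd n), v (bnd n)]%classic = `]- r, r[%classic.
Proof.
have vlt := group_speed_lt _ r0 r1.
have vle : {in `[- (pi / 2), pi / 2] &, {homo v : x y / x <= y}}.
  move=> x y xi yi; rewrite le_eqVlt => /orP[/eqP->//|xy]; apply/ltW; exact: vlt.
have pile := @pihalf_ge1 R.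
have bi n : bnd n \in `[- (pi / 2), pi / 2].
  by rewrite in_itv /=; have := bnd_lt n; have := bnd_gt0 n => ? ?; apply/andP; split; lra.
have bNi n : - bnd n \in `[- (pi / 2), pi / 2].
  by rewrite in_itv /=; have := bnd_lt n; have := bnd_gt0 n => ? ?; apply/andP; split; lra.
apply/seteqP; split=> x /=.
  move=> [n _] /=; rewrite !in_itv /= group_speedN => /andP[? ?].
  have : v (bnd n) < r.
    rewrite -[X in _ < X](group_speed_pihalf r).
    by apply: vlt => //; rewrite in_itv /=; apply/andP; split; lra.
  by move=> ?; apply/andP; split; lra.
rewrite in_itv /= -ltr_norml => /(group_speed_surj _ r0 r1)[th thpi <-].
have : `|th| < pi / 2 by rewrite ltr_norml.
move=> /bnd_ex[n]; rewrite ler_norml => /andP[n1 n2]; exists n => //=.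
rewrite in_itv /=; apply/andP.
have thi : th \in `[- (pi / 2), pi / 2].
  by rewrite in_itv /=; move/andP: thpi => [? ?]; apply/andP; split; lra.
by split; apply: vle.
Qed.

(** Both sides are monotone limits over the intervals [[- bnd n, bnd n]] and their images under [v],
    on which [integral_subst] applies. The finite right-hand side later yields integrability. *)
Lemma integral_konno_density_ge0 : (forall x : R, -1 <= x <= 1 -> 0 <= g x) ->
  (\int[mu]_x (g x * f x)%R%:E =
   (\int[mu]_(th in `[(- (pi / 2))%R, (pi / 2)%R]) pull th)%R%:E)%E.
Proof.
move=> g0; have rlt1 := r1.
have vlt := group_speed_lt _ r0 r1.
have bi n : bnd n \in `[- (pi / 2), pi / 2].
  by rewrite in_itv /=; have := bnd_lt n; have := bnd_gt0 n => ? ?; apply/andP; split; lra.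
have bNi n : - bnd n \in `[- (pi / 2), pi / 2].
  by rewrite in_itv /=; have := bnd_lt n; have := bnd_gt0 n => ? ?; apply/andP; split; lra.
have vle : {in `[- (pi / 2), pi / 2] &, {homo v : x y / x <= y}}.
  move=> x y xi yi; rewrite le_eqVlt => /orP[/eqP->//|xy]; apply/ltW; exact: vlt.
have pull0 (th : R) : 0 <= pull th.
  have vr := group_speed_bound _ r0 r1 th.
  rewrite /pull mulr_ge0 ?invr_ge0 ?pi_ge0// mulr_ge0 ?tilt_ge0//.
  by apply: g0; move: vr; rewrite ler_norml => /andP[? ?]; apply/andP; split; lra.
have mpull A : measurable_fun A (EFin \o pull).
  apply/measurable_EFinP; apply: measurable_funTS.
  by apply: continuous_measurable_fun; exact: continuous_pull.
have mgG : measurable_fun `]- r, r[ (EFin \o (fun x => g x * G x)).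
  apply/measurable_EFinP; apply: measurable_funM.
    by apply: measurable_funTS; exact: continuous_measurable_fun.
  apply: open_continuous_measurable_fun; first exact: interval_open.
  by move=> x; rewrite inE /= in_itv /= -ltr_norml => /continuous_G.
have sub n : `[v (- bnd n), v (bnd n)] `<=` `]- r, r[.
  by rewrite -union_x => x xn; exists n.
have c1 : (\int[mu]_(th in `[(- bnd n)%R, bnd n]) (pull th)%:E)%E @[n --> \oo] -->
   (\int[mu]_(th in `](- (pi / 2))%R, (pi / 2)%R[) (pull th)%:E)%E.
  rewrite -union_th; apply: ge0_nondecreasing_set_cvg_integral => //.
  - move=> m n mn; apply/subsetPset => x /=; rewrite !in_itv /= => /andP[? ?].
    by have := bnd_nd _ _ mn => ?; apply/andP; split; lra.
  - by move=> n; exact: mpull.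
  - by move=> n x _; rewrite lee_fin.
have c2 : (\int[mu]_(x in `[v (- bnd n)%R, v (bnd n)]) (g x * G x)%R%:E)%E @[n --> \oo] -->
   (\int[mu]_(x in `](- r)%R, r[) (g x * G x)%R%:E)%E.
  rewrite -union_x; apply: ge0_nondecreasing_set_cvg_integral => //.
  - move=> m n mn; apply/subsetPset => x /=; rewrite !in_itv /= => /andP[x1 x2].
    have mn' := bnd_nd _ _ mn; apply/andP; split.
      by apply: le_trans x1; apply: vle => //; rewrite lerN2.
    by apply: le_trans x2 _; apply: vle.
  - move=> n; apply: measurable_funS mgG => //; exact: sub.
  - move=> n x /sub /=; rewrite in_itv /= -ltr_norml => xr; rewrite lee_fin mulr_ge0 ?G_ge0//.
    by apply: g0; move: xr; rewrite ltr_norml => /andP[? ?]; apply/andP; split; lra.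
have -> : (\int[mu]_x (g x * f x)%R%:E = \int[mu]_(x in `](- r)%R, r[) (g x * G x)%R%:E)%E.
  rewrite [RHS]integral_mkcond; apply: eq_integral => x _.
  by rewrite konno_densityE /patch; case: ifPn => //; rewrite mulr0.
have -> : (\int[mu]_(x in `](- r)%R, r[) (g x * G x)%R%:E =
   \int[mu]_(th in `](- (pi / 2))%R, (pi / 2)%R[) (pull th)%:E)%E.
  move: c2; rewrite (_ : (fun n => _) =
      (fun n => \int[mu]_(th in `[(- bnd n)%R, bnd n]) (pull th)%:E)%E); last first.
    by apply/funext => n; rewrite integral_subst.
  by move=> c2; exact: (cvg_unique _ c2 c1).
rewrite -(@integral_itv_bndoo _ _ _ _ true false)//.
rewrite /Rintegral fineK//; apply: integrable_fin_num => //.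
apply: continuous_compact_integrable; first exact: segment_compact.
exact/continuous_subspaceT/continuous_pull.
Qed.

End konno_density.

Lemma integrable_itv_continuous {R : realType} (h : R -> R) (a b : R) :
  continuous h -> lebesgue_measure.-integrable `[a, b] (EFin \o h).
Proof.
move=> ch; apply: continuous_compact_integrable; first exact: segment_compact.
exact: continuous_subspaceT.
Qed.

Lemma Rintegral_linear {R : realType} (h k : R -> R) (a b c d : R) :
  continuous h -> continuous k ->
  \int[lebesgue_measure]_(x in `[a, b]) (c * h x + d * k x) =
  c * \int[lebesgue_measure]_(x in `[a, b]) h x +
  d * \int[lebesgue_measure]_(x in `[a, b]) k x.
Proof.
move=> ch ck; rewrite -!RintegralZl//; try exact: integrable_itv_continuous.
have cM e (q : R -> R) : continuous q -> continuous (fun x => e * q x).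
  by move=> cq x; apply: cvgMr; exact: cq.
by rewrite RintegralD//; apply: integrable_itv_continuous; exact: cM.
Qed.

(** * Moments and Fourier transform of the limit density *)

Section konno_moments.
Context {R : realType}.
Variables (r l : R).
Hypotheses (r0 : 0 < r) (r1 : r < 1) (lr : `|l| * r <= 1).
Notation mu := (@lebesgue_measure R).
Notation v := (group_speed r).
Notation s := (Num.sqrt (1 - r ^+ 2)).
Notation f := (konno_density r l).

Notation D := ([set` `[- (pi / 2), pi / 2]]).
Let J (g : R -> R) := \int[mu]_(th in D) (pi^-1 * (g (v th) * (1 - l * v th))).

Let cv := continuous_group_speed _ r0 r1.

Let pihalf_ge0 : 0 <= pi / 2 :> R. Proof. by rewrite divr_ge0 ?pi_ge0. Qed.

Let J_shift (g : R -> R) (M : R) : continuous g ->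
  J (fun x => g x + M) = J g + M * J (fun=> 1).
Proof.
move=> cg; transitivity (1 * J g + M * J (fun=> 1)); last by rewrite mul1r.
rewrite /J -Rintegral_linear; first by apply: eq_Rintegral => x _; ring.
- exact: continuous_pull.
- by apply: (continuous_pull r l r0 r1 (fun=> 1)) => x; exact: cvg_cst.
Qed.

(** As [v] is odd, the tilt [l v] times an even function integrates to 0; for odd functions, treated
    in [J_odd], only the tilt survives. *)
Let J_even (g : R -> R) : continuous g -> (forall x, g (- x) = g x) ->
  J g = pi^-1 * \int[mu]_(th in D) g (v th).
Proof.
move=> cg eg; have cgv : continuous (g \o v).
  by move=> x; apply: continuous_comp; [exact: cv|exact: cg].
have cvg' : continuous (fun x => v x * g (v x)).
  by move=> x; apply: cvgM; [exact: cv|exact: cgv].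
transitivity (pi^-1 * \int[mu]_(th in D) g (v th) +
    (- (pi^-1 * l)) * \int[mu]_(th in D) (v th * g (v th))).
  rewrite -Rintegral_linear//; apply: eq_Rintegral => x _; ring.
rewrite (@integral_odd R (fun th => v th * g (v th)) _ pihalf_ge0 cvg') ?mulr0 ?addr0//.
by move=> x; rewrite group_speedN eg mulNr.
Qed.

Let J_odd (g : R -> R) : continuous g -> (forall x, g (- x) = - g x) ->
  J g = pi^-1 * \int[mu]_(th in D) (- l * (v th * g (v th))).
Proof.
move=> cg eg; have cgv : continuous (g \o v).
  by move=> x; apply: continuous_comp; [exact: cv|exact: cg].
have cvg' : continuous (fun x => v x * g (v x)).
  by move=> x; apply: cvgM; [exact: cv|exact: cgv].
transitivity (pi^-1 * \int[mu]_(th in D) g (v th) +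
    pi^-1 * \int[mu]_(th in D) (- l * (v th * g (v th)))).
  rewrite -Rintegral_linear//; last first.
    by move=> x; apply: cvgMr; exact: cvg'.
  apply: eq_Rintegral => x _; ring.
rewrite (@integral_odd R (g \o v) _ pihalf_ge0 cgv) ?mulr0 ?add0r//.
by move=> x /=; rewrite group_speedN eg.
Qed.

Let J1 : J (fun=> 1) = 1.
Proof.
rewrite J_even//; last by move=> x; exact: cvg_cst.
rewrite (@Rintegral_is_derive R (fun=> 1) id) //.
- by rewrite opprK -splitr mulVf// gt_eqF// pi_gt0.
- by have := pi_gt0 R; lra.
- by move=> x; exact: cvg_cst.
Qed.

Lemma integral_konno_density1 : (\int[mu]_x (f x)%:E = 1%:E)%E.
Proof.
rewrite -J1 -(integral_konno_density_ge0 _ _ r0 r1 lr (fun=> 1)) //.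
- by apply: eq_integral => x _; rewrite mul1r.
- by move=> x; exact: cvg_cst.
Qed.

Lemma integrable_konno_density : mu.-integrable setT (EFin \o f).
Proof.
apply/integrableP; split.
  by apply/measurable_EFinP; exact: measurable_konno_density.
rewrite (_ : (\int[mu]_x _ = 1%:E)%E) ?ltry// -integral_konno_density1.
by apply: eq_integral => x _ /=; rewrite ger0_norm// konno_density_ge0.
Qed.

(** Adding [M] makes [g] nonnegative on the support; the integral of [M * f] is then subtracted, [f]
    having mass 1. *)
Lemma integral_konno_density (g : R -> R) (M : R) : continuous g ->
  (forall x : R, -1 <= x <= 1 -> - M <= g x) ->
  mu.-integrable setT (fun x => (g x * f x)%:E) /\
  (\int[mu]_x (g x * f x)%R%:E = (J g)%:E)%E.
Proof.
move=> cg gM; pose gm x := g x + M.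
have cgm : continuous gm by move=> x; apply: cvgD; [exact: cg|exact: cvg_cst].
have gm0 (x : R) : -1 <= x <= 1 -> 0 <= gm x by move=> /gM; rewrite /gm; lra.
have gmf0 x : 0 <= gm x * f x.
  have [x1|x1] := boolP (-1 <= x <= 1).
    by rewrite mulr_ge0 ?gm0 ?konno_density_ge0.
  by rewrite konno_density_out ?mulr0.
have E := integral_konno_density_ge0 _ _ r0 r1 lr gm cgm gm0.
have mf := measurable_konno_density r l r0 r1.
have igm : mu.-integrable setT (EFin \o (fun x => gm x * f x)).
  apply/integrableP; split.
    apply/measurable_EFinP; apply: measurable_funM => //.
    exact: continuous_measurable_fun.
  rewrite (_ : (\int[mu]_x _ = (J gm)%:E)%E) ?ltry// -E.
  by apply: eq_integral => x _ /=; rewrite ger0_norm.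
have iMf : mu.-integrable setT (EFin \o (fun x => M * f x)).
  have -> : EFin \o (fun x => M * f x) = (fun x => M%:E * (f x)%:E)%E.
    by apply/funext => y /=; rewrite EFinM.
  by apply: integrableZl => //; exact: integrable_konno_density.
pose A x := (gm x * f x)%:E; pose B x := (M * f x)%:E.
have gE x : (g x * f x)%:E = (A x - B x)%E.
  by rewrite /A /B -EFinB /gm; congr EFin; ring.
split.
  by rewrite (_ : (fun x => _) = (fun x => A x - B x)%E); [exact: integrableB|exact/funext].
under eq_integral do rewrite gE.
rewrite integralB// {1}/A E /B (_ : (\int[mu]_x (M * f x)%R%:E = M%:E)%E).
  by rewrite -EFinB; congr EFin; rewrite -/(J gm) J_shift// J1 mulr1 addrK.
under eq_integral do rewrite EFinM.
rewrite integralZl//; last exact: integrable_konno_density.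
by rewrite integral_konno_density1 mule1.
Qed.

(** [J_odd] leaves [- l / pi] times the integral of [v^2], while [J_even] gives [1 / pi] times it
    for the second moment: hence the common factor [1 - s]. *)
Lemma integral_konno_mean :
  mu.-integrable setT (fun x => (x * f x)%:E) /\
  (\int[mu]_x (x * f x)%R%:E = (- l * (1 - s))%:E)%E.
Proof.
have cid : continuous (id : R -> R) by move=> x; exact: cvg_id.
have [|i ->] := integral_konno_density id 1 cid; first by move=> x /andP[].
split => //; congr EFin; rewrite J_odd// RintegralZl//.
  rewrite (_ : \int[mu]_(th in D) (v th * v th) = pi * (1 - s)).
    by rewrite mulrCA mulKf// gt_eqF// pi_gt0.
  rewrite -(integral_group_speed_sqr _ r0 r1).
  by apply: eq_Rintegral => x _; rewrite expr2.
apply: (@integrable_itv_continuous _ (fun th => v th * v th)) => x.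
by apply: cvgM; exact: cv.
Qed.

Lemma integral_konno_second_moment :
  (\int[mu]_x (x ^+ 2 * f x)%R%:E = (1 - s)%:E)%E.
Proof.
have cX : continuous (fun x : R => x ^+ 2) by exact: exprn_continuous.
have [|_ ->] := integral_konno_density (fun x => x ^+ 2) 0 cX.
  by move=> x _; rewrite oppr0 sqr_ge0.
congr EFin; rewrite J_even//; last by move=> x; rewrite sqrrN.
by rewrite (integral_group_speed_sqr _ r0 r1) mulKf// gt_eqF// pi_gt0.
Qed.

Let continuous_dil (h : R -> R) (xi : R) : continuous h -> continuous (fun x => h (xi * x)).
Proof.
move=> ch x; apply: (@continuous_comp _ _ _ (fun y : R => xi * y) h); last exact: ch.
by apply: cvgMr; exact: cvg_id.
Qed.

Lemma integral_konno_cos xi :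
  \int[mu]_x (cos (xi * x) * f x) =
  pi^-1 * \int[mu]_(th in `[- (pi / 2), pi / 2]) cos (xi * v th).
Proof.
have cc := continuous_dil _ xi (@continuous_cos R).
have [|_ E] := integral_konno_density _ 1 cc; first by move=> x _; exact: cos_geN1.
by rewrite /Rintegral E /= J_even// => x; rewrite mulrN cosN.
Qed.

Lemma integral_konno_sin xi :
  \int[mu]_x (sin (xi * x) * f x) =
  pi^-1 * \int[mu]_(th in `[- (pi / 2), pi / 2]) (- l * (v th * sin (xi * v th))).
Proof.
have cs := continuous_dil _ xi (@continuous_sin R).
have [|_ E] := integral_konno_density _ 1 cs; first by move=> x _; exact: sin_geN1.
by rewrite /Rintegral E /= J_odd// => x; rewrite mulrN sinN.
Qed.

End konno_moments.

(** * Polar form of the coin and support of the amplitudes *)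

Definition expi {R : realType} (x : R) : R[i] := (cos x +i* sin x)%C.

Lemma expiD {R : realType} (x y : R) : expi (x + y) = expi x * expi y.
Proof. by rewrite /expi cosD sinD; simpc; congr (_ +i* _)%C; rewrite addrC. Qed.

Lemma conj_expi {R : realType} (x : R) : conjc (expi x) = expi (- x).
Proof. by rewrite /expi cosN sinN. Qed.

Lemma expi0 {R : realType} : expi (0 : R) = 1.
Proof. by rewrite /expi cos0 sin0. Qed.

Lemma expiNK {R : realType} (x : R) : expi x * expi (- x) = 1.
Proof. by rewrite -expiD subrr expi0. Qed.

Lemma sqr_cabs {R : realType} (z : R[i]) :
  ((cabs z ^+ 2)%:C)%C = z * conjc z.
Proof.
case: z => x y; rewrite /cabs /= sqr_sqrtr ?addr_ge0 ?sqr_ge0//.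
by simpc; congr (_ +i* _)%C; ring.
Qed.

Lemma cabs_gt0 {R : realType} (z : R[i]) : z != 0 -> 0 < cabs z.
Proof.
move=> z0; rewrite lt_neqAle; apply/andP; split.
  by rewrite eq_sym; apply: contra z0 => /eqP/Normc.eq0_normc ->.
by case: {z0} z => x y; exact: sqrtr_ge0.
Qed.

Lemma conjcM {R : realType} (x y : R[i]) : conjc (x * y) = conjc x * conjc y.
Proof. exact: rmorphM. Qed.

Lemma conjcD {R : realType} (x y : R[i]) : conjc (x + y) = conjc x + conjc y.
Proof. exact: rmorphD. Qed.

Lemma conjcN {R : realType} (x : R[i]) : conjc (- x) = - conjc x.
Proof. exact: rmorphN. Qed.

Lemma conjcX {R : realType} (x : R[i]) n : conjc (x ^+ n) = conjc x ^+ n.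
Proof. exact: rmorphXn. Qed.

Lemma unit_expi {R : realType} (z : R[i]) : z * conjc z = 1 -> exists t, z = expi t.
Proof.
case: z => x y; simpc => -[H _].
have H1 : x ^+ 2 + y ^+ 2 = 1 by rewrite -H; ring.
have x1 : -1 <= x <= 1.
  by have := sqr_ge0 y; move=> y0; apply/andP; split; nra.
have sy : Num.sqrt (1 - x ^+ 2) = `|y|.
  by rewrite -sqrtr_sqr -H1; congr Num.sqrt; ring.
have ac : cos (acos x) = x by rewrite acosK// in_itv.
have [y0|y0] := leP 0 y.
  by exists (acos x); rewrite /expi ac sin_acos// sy ger0_norm.
exists (- acos x); rewrite /expi cosN sinN ac sin_acos// sy ltr0_norm//.
by rewrite opprK.
Qed.

Section unitary.
Context {R : realType}.
Implicit Types a b c d alpha beta : R[i].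

Lemma unitary2_eqs a b c d : unitary2 a b c d ->
  [/\ a * conjc a + b * conjc b = 1, a * conjc c + b * conjc d = 0 &
      c * conjc c + d * conjc d = 1].
Proof.
move=> U; have E i j := congr1 (fun M : 'M[R[i]]_2 => M i j) U.
split.
- by have := E 0 0; rewrite !mxE big_ord_recr big_ord1 /= !mxE.
- by have := E 0 1; rewrite !mxE big_ord_recr big_ord1 /= !mxE.
- by have := E 1 1; rewrite !mxE big_ord_recr big_ord1 /= !mxE.
Qed.

(** The coin is the scalar [expi eta], times the diagonal matrix of [expi kappa] and
    [expi (- kappa)], times the matrix with rows [(r, B)] and [(- conjc B, r)]. The scalar drops out
    of inner products at equal times; the diagonal matrix looks like a step in Fourier space and
    merely translates the frequency. *)
Lemma unitary2_polar a b c d : unitary2 a b c d -> a * b * c * d != 0 ->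
  let r := (cabs a)%:C%C in
  exists (eta kappa : R) (B : R[i]),
  [/\ 0 < cabs a < 1,
      B * conjc B = ((1 - cabs a ^+ 2)%:C)%C /\ B = b * conjc a / r,
      a = expi eta * r * expi kappa /\ b = expi eta * expi kappa * B
    & c = - (expi eta * expi (- kappa) * conjc B) /\ d = expi eta * r * expi (- kappa)].
Proof.
move=> /unitary2_eqs[ab ac cd]; rewrite !mulf_eq0 !negb_or -!andbA => /and4P[a0 b0 c0 d0] r.
have ra := cabs_gt0 _ a0.
have r0 : r != 0.
  by apply/eqP => /complexI/eqP; rewrite gt_eqF.
have rr : r * r = a * conjc a by rewrite -sqr_cabs /r -rmorphM expr2.
have ca0 : conjc a != 0 by rewrite conjc_eq0.
(* [D] is the determinant of the coin, of modulus 1, and [eta] will be half its argument. *)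
pose D := d / conjc a.
have cE : c = - (D * conjc b).
  have : conjc (a * conjc c + b * conjc d) = 0 by rewrite ac conjc0.
  rewrite rmorphD !rmorphM /= !conjcK => /eqP; rewrite addr_eq0 => /eqP E.
  apply: (mulfI ca0); rewrite E /D; field.
  exact: ca0.
have dE : d = D * conjc a by rewrite /D divfK.
have DD : D * conjc D = 1.
  have : c * conjc c + d * conjc d = D * conjc D * (a * conjc a + b * conjc b).
    by rewrite cE {1 2}dE !rmorphN !rmorphM /= !conjcK; ring.
  by rewrite cd ab mulr1.
have [t DE] := unit_expi _ DD.
pose eta := t / 2.
have De : D = expi eta * expi eta by rewrite -expiD /eta -splitr.
have une : expi eta * conjc (expi eta) = 1 by rewrite conj_expi expiNK.
have [|kappa kE] := unit_expi (a / r * conjc (expi eta)).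
  rewrite !conjcM conjcK conjc_inv.
  have -> : conjc r = r by rewrite /r conjc_real.
  transitivity ((a * conjc a) / (r * r) * (expi eta * conjc (expi eta))).
    by field.
  by rewrite une mulr1 rr divff// mulf_neq0.
have kE' : conjc a / r * expi eta = expi (- kappa).
  rewrite -conj_expi -kE !conjcM conjcK conjc_inv.
  by congr (_ * _^-1 * _); rewrite /r conjc_real.
exists eta, kappa, (b * conjc a / r); split.
- rewrite ra /=.
  have : ((cabs a ^+ 2 + cabs b ^+ 2)%:C)%C = (1%:C)%C :> R[i].
    by rewrite rmorphD /= !sqr_cabs ab.
  move=> /complexI; have := cabs_gt0 _ b0; nra.
- split=> //; rewrite !conjcM conjcK conjc_inv.
  have -> : conjc r = r by rewrite /r conjc_real.
  transitivity ((a * conjc a) / (r * r) * (b * conjc b)); first by field.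
  rewrite rr divff ?mulf_neq0// mul1r rmorphB rmorph1 /= sqr_cabs -ab.
  by ring.
- split.
    rewrite -kE; transitivity (a * (expi eta * conjc (expi eta))).
      by rewrite une mulr1.
    by field.
  rewrite -kE; transitivity (b * ((a * conjc a) / (r * r)) * (expi eta * conjc (expi eta))).
    by rewrite une rr divff ?mulf_neq0// !mulr1.
  by field.
- split.
    rewrite -kE' cE De !conjcM conjcK conjc_inv.
    have -> : conjc r = r by rewrite /r conjc_real.
    congr (- _).
    transitivity (expi eta * expi eta * conjc b * ((a * conjc a) / (r * r))).
      by rewrite rr divff ?mulf_neq0// mulr1.
    by field.
  rewrite -kE' {1}dE De; field.
  exact: r0.
Qed.

Section amplitudes.
Variables (a b c d alpha beta : R[i]).
Notation amp := (qw_amp a b c d alpha beta).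

Lemma qw_amp0 n k : amp n.+1 k 0 0 = a * amp n (k + 1) 0 0 + b * amp n (k + 1) 1 0.
Proof.
rewrite /= !mxE !big_ord_recr !big_ord0 /= !mxE /= !mul0r !addr0 !add0r.
congr (_ * _ + _ * _); congr (qw_amp _ _ _ _ _ _ _ _ _ _); exact/val_inj.
Qed.

Lemma qw_amp1 n k : amp n.+1 k 1 0 = c * amp n (k - 1) 0 0 + d * amp n (k - 1) 1 0.
Proof.
rewrite /= !mxE !big_ord_recr !big_ord0 /= !mxE /= !mul0r !addr0 !add0r.
congr (_ * _ + _ * _); congr (qw_amp _ _ _ _ _ _ _ _ _ _); exact/val_inj.
Qed.

Lemma qw_amp_support n k i : (n%:Z < `|k|)%R -> amp n k i 0 = 0.
Proof.
elim: n k i => [|n IH] k i.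
  by rewrite normr_gt0 /= => /negbTE ->; rewrite mxE.
move=> nk; rewrite /= !mxE !big1 ?addr0// => j _; rewrite IH ?mulr0//; lia.
Qed.

End amplitudes.
End unitary.

(** * Fourier transform of the amplitudes *)

Lemma continuous_sum_nat {R : realType} (K : nat) (h : nat -> R -> R) :
  (forall i, continuous (h i)) -> continuous (fun x => \sum_(0 <= i < K) h i x).
Proof.
move=> ch; elim: K => [|K IH].
  under eq_fun do rewrite big_geq//.
  by move=> x; exact: cvg_cst.
under eq_fun do rewrite big_nat_recr//=.
by move=> x; apply: cvgD; [exact: IH|exact: ch].
Qed.

Lemma Rintegral_sum_nat {R : realType} (K : nat) (h : nat -> R -> R) (a b : R) :
  (forall i, continuous (h i)) ->
  \int[lebesgue_measure]_(x in `[a, b]) (\sum_(0 <= i < K) h i x) =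
  \sum_(0 <= i < K) \int[lebesgue_measure]_(x in `[a, b]) h i x.
Proof.
move=> ch; elim: K => [|K IH].
  rewrite big_geq//; under eq_Rintegral do rewrite big_geq//.
  by rewrite Rintegral_cst// mul0r.
rewrite big_nat_recr//= -IH.
transitivity (1 * \int[lebesgue_measure]_(x in `[a, b]) (\sum_(0 <= i < K) h i x) +
   1 * \int[lebesgue_measure]_(x in `[a, b]) h K x); last by rewrite !mul1r.
rewrite -Rintegral_linear//; last exact: continuous_sum_nat.
by apply: eq_Rintegral => x _; rewrite big_nat_recr//= !mul1r.
Qed.

Section parseval.
Context {R : realType}.
Notation C := R[i].
Notation Re := (@complex.Re R).
Notation period := ([set` `[- (pi / 2) : R, pi / 2 + pi]]).

Lemma expi_2pi (m : int) : expi (m%:~R * (pi *+ 2)) = 1 :> C.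
Proof.
have nat_case (n : nat) : expi (n%:R * (pi *+ 2)) = 1 :> C.
  elim: n => [|n IH]; first by rewrite mul0r expi0.
  by rewrite -natr1 mulrDl expiD IH !mul1r /expi cos2pi sin2pi.
case: m => n; first exact: nat_case.
by rewrite NegzE mulrNz mulNr -conj_expi nat_case conjc1.
Qed.

Let harmonic (g : C) (m : int) (x : R) := Re (g * expi (m%:~R * x)).

Let harmonicE g m x : harmonic g m x = Re g * cos (m%:~R * x) - complex.Im g * sin (m%:~R * x).
Proof. by rewrite /harmonic /expi; case: g => g1 g2; simpc. Qed.

Let is_derive_dil (h dh : R -> R) (m x : R) : (forall y : R, is_derive y 1 h (dh y)) ->
  is_derive x 1 (fun y => h (m * y)) (m * dh (m * x)).
Proof.
move=> H; have D : is_derive x 1 (fun y : R => m * y) m.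
  have -> : (fun y : R => m * y) = (m \*: id) by apply/funext.
  by apply: is_derive_eq; rewrite /GRing.scale /= mulr1.
by have := @is_derive1_comp R h (fun y => m * y) x _ _ (H _) D; rewrite mulrC.
Qed.

Let continuous_harmonic g m : continuous (harmonic g m).
Proof.
move=> x; rewrite (funext (harmonicE g m)).
apply: cvgB; apply: cvgMr.
  exact: is_derive_continuous (is_derive_dil _ _ m%:~R x (@is_derive_cos R)).
exact: is_derive_continuous (is_derive_dil _ _ m%:~R x (@is_derive_sin R)).
Qed.

Let integral_harmonic g m : \int[lebesgue_measure]_(x in period) harmonic g m x =
  if m == 0 then pi *+ 2 * Re g else 0.
Proof.
have lt : - (pi / 2) < pi / 2 + pi :> R by have := pi_gt0 R; lra.
case: eqP => [->|/eqP m0].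
  have D (x : R) : is_derive x 1 (fun y : R => Re g * y) (harmonic g 0 x).
    rewrite harmonicE mul0r cos0 sin0 mulr1 mulr0 subr0.
    have -> : (fun y : R => Re g * y) = (Re g \*: id) by apply/funext.
    by apply: is_derive_eq; rewrite /GRing.scale /= mulr1.
  rewrite (Rintegral_is_derive _ _ _ _ lt (continuous_harmonic g 0) D).
  by rewrite mulr2n; field.
have mR : m%:~R != 0 :> R by rewrite intr_eq0.
pose A x : R := m%:~R^-1 * (Re g * sin (m%:~R * x) + complex.Im g * cos (m%:~R * x)).
have D (x : R) : is_derive x 1 A (harmonic g m x).
  rewrite harmonicE.
  have Ds := is_derive_dil _ _ m%:~R x (@is_derive_sin R).
  have Dc := is_derive_dil _ _ m%:~R x (@is_derive_cos R).
  have -> : A = m%:~R^-1 \*: (Re g \*: (fun y => sin (m%:~R * y)) +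
                              complex.Im g \*: (fun y => cos (m%:~R * y))).
    by apply/funext.
  by apply: is_derive_eq; rewrite ?fctE /GRing.scale /=; field.
rewrite (Rintegral_is_derive _ _ _ _ lt (continuous_harmonic g m) D).
have -> : pi / 2 + pi = - (pi / 2) + pi *+ 2 :> R by rewrite mulr2n; field.
rewrite /A; have := expi_2pi m.
move=> /(congr1 (fun z => expi (m%:~R * - (pi / 2)) * z)).
rewrite -expiD -mulrDr mulr1 => -[-> ->].
by rewrite subrr.
Qed.

(** The product expands into harmonics of frequency [k j - k i]; over a period only frequency 0
    survives, that is the diagonal for injective [k]. The period starts at [- (pi / 2)] so as to
    consist of the interval where [v] increases and its translate by [pi]. *)
Lemma continuous_parseval (K : nat) (k : nat -> int) (u w : nat -> C) :
  continuous (fun x : R => Re (conjc (\sum_(0 <= i < K) u i * expi ((k i)%:~R * x)) *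
              (\sum_(0 <= j < K) w j * expi ((k j)%:~R * x)))) /\
  (injective k ->
  \int[lebesgue_measure]_(x in period)
     Re (conjc (\sum_(0 <= i < K) u i * expi ((k i)%:~R * x)) *
              (\sum_(0 <= j < K) w j * expi ((k j)%:~R * x))) =
  pi *+ 2 * \sum_(0 <= i < K) Re (conjc (u i) * w i)).
Proof.
have E x : Re (conjc (\sum_(0 <= i < K) u i * expi ((k i)%:~R * x)) *
              (\sum_(0 <= j < K) w j * expi ((k j)%:~R * x))) =
   \sum_(0 <= i < K) \sum_(0 <= j < K) harmonic (conjc (u i) * w j) (k j - k i) x.
  rewrite rmorph_sum mulr_suml raddf_sum; apply: eq_bigr => i _.
  rewrite mulr_sumr raddf_sum; apply: eq_bigr => j _.
  rewrite /harmonic rmorphB /= mulrBl expiD -conj_expi conjcM; congr Re; ring.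
have cs i : continuous (fun x => \sum_(0 <= j < K) harmonic (conjc (u i) * w j) (k j - k i) x).
  by apply: continuous_sum_nat => j; exact: continuous_harmonic.
split.
  under eq_fun do rewrite E.
  exact: continuous_sum_nat.
move=> kinj; under eq_Rintegral do rewrite E.
rewrite Rintegral_sum_nat// mulr_sumr.
rewrite !big_nat; apply: eq_bigr => i /andP[_ iK].
rewrite Rintegral_sum_nat//.
rewrite (bigD1_seq i) ?mem_index_iota ?iota_uniq//= big1 ?addr0.
  by rewrite integral_harmonic subrr eqxx.
move=> j ji; rewrite integral_harmonic subr_eq0; case: eqP => // /kinj E'.
by rewrite E' eqxx in ji.
Qed.

End parseval.

(** * Powers of the walk matrix at a fixed frequency *)

Section closed_form.
Context {R : realType}.
Notation C := R[i].
Variables (a b c d alpha beta : C) (r eta kappa : R) (B : C).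
Hypotheses (r0 : 0 < r) (r1 : r < 1)
  (BB : B * conjc B = ((1 - r ^+ 2)%:C)%C)
  (aE : a = expi eta * (r%:C)%C * expi kappa) (bE : b = expi eta * expi kappa * B)
  (cE : c = - (expi eta * expi (- kappa) * conjc B))
  (dE : d = expi eta * (r%:C)%C * expi (- kappa)).
Notation amp := (qw_amp a b c d alpha beta).
Notation S := (sin_phase r).

Definition site (M i : nat) : int := i%:Z - M%:Z.

(** A finite sum over the window of sites [-M, ..., M]; evaluating at [th + kappa] absorbs the
    diagonal phases of the coin. *)
Definition fourier (M : nat) (h : int -> C) (th : R) : C :=
  \sum_(0 <= i < (2 * M).+1) h (site M i) * expi ((site M i)%:~R * (th + kappa)).

(** Reindexing moves the window by one site; the two sums differ by the terms at the site that
    leaves and the site that enters, both zero by hypothesis. *)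
Lemma fourier_shift (M : nat) (h : int -> C) (th : R) :
  h (- M%:Z) = 0 -> h (M.+1)%:Z = 0 ->
  fourier M (fun k => h (k + 1)) th = expi (- (th + kappa)) * fourier M h th.
Proof.
move=> h1 h2; rewrite /fourier mulr_sumr.
pose g k := h k * expi ((k%:~R - 1) * (th + kappa)).
transitivity (\sum_(0 <= i < (2 * M).+1) g (site M i.+1)).
  apply: eq_bigr => i _; rewrite /g.
  have -> : site M i.+1 = site M i + 1 by rewrite /site; lia.
  by rewrite intrD addrK.
transitivity (\sum_(0 <= i < (2 * M).+1) g (site M i)); last first.
  by apply: eq_bigr => i _; rewrite /g mulrCA -expiD; congr (_ * expi _); ring.
have := telescope_sumr (fun i => g (site M i)) (leq0n (2 * M).+1).
rewrite sumrB => /eqP; rewrite subr_eq => /eqP ->.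
have -> : site M (2 * M).+1 = (M.+1)%:Z by rewrite /site; lia.
have -> : site M 0 = - M%:Z by rewrite /site; lia.
by rewrite /g h1 h2 !mul0r subrr add0r.
Qed.

Lemma fourier_shiftN (M : nat) (h : int -> C) (th : R) :
  h M%:Z = 0 -> h (- (M.+1)%:Z) = 0 ->
  fourier M (fun k => h (k - 1)) th = expi (th + kappa) * fourier M h th.
Proof.
move=> h1 h2; rewrite -[LHS]mul1r -(expiNK (th + kappa)) -mulrA.
rewrite -fourier_shift; first by congr (_ * _); apply: eq_bigr => i _; rewrite addrK.
- by rewrite (_ : _ - 1 = - (M.+1)%:Z)//; lia.
- by rewrite (_ : _ - 1 = M%:Z)//; lia.
Qed.

Lemma fourierD M (x y : C) (h k : int -> C) th :
  fourier M (fun j => x * h j + y * k j) th = x * fourier M h th + y * fourier M k th.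
Proof.
by rewrite /fourier !mulr_sumr -big_split /=; apply: eq_bigr => i _; ring.
Qed.

Lemma fourier_delta0 M (h : int -> C) th : (forall k, k != 0 -> h k = 0) ->
  fourier M h th = h 0.
Proof.
move=> h0; rewrite /fourier (bigD1_seq M) ?mem_index_iota ?iota_uniq//=; last by lia.
rewrite /site subrr mul0r expi0 mulr1 big1 ?addr0// => i iM.
by rewrite h0 ?mul0r//; lia.
Qed.

(* The unitary 2x2 matrix of the walk at frequency [th], divided by [expi eta], is
   [cos om + chi] with [chi] traceless skew-hermitian and [chi^2 = - S^2]. *)
Definition chi1 (th : R) : C :=
  - (0 +i* (r * sin th))%C * alpha + B * expi (- th) * beta.
Definition chi2 (th : R) : C :=
  - (conjc B * expi th * alpha) + (0 +i* (r * sin th))%C * beta.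

Definition phase (th : R) : R := acos (r * cos th).
(** [cosn n] and [sinn n] are the Chebyshev polynomials [T_n] and, for [n > 0], [U_(n-1)] at
    [r cos th]. *)
Definition cosn (n : nat) (th : R) : R := cos (n%:R * phase th).
Definition sinn (n : nat) (th : R) : R := sin (n%:R * phase th) / S th.

Lemma rcos_bound (th : R) : -1 < r * cos th < 1.
Proof.
have c1 := cos_geN1 th; have c2 := cos_le1 th; have H := r0; have H1 := r1.
by apply/andP; split; nra.
Qed.

Lemma cos_phase th : cos (phase th) = r * cos th.
Proof. by rewrite acosK// in_itv /=; have /andP[? ?] := rcos_bound th; rewrite !ltW. Qed.

Lemma sin_phaseE th : sin (phase th) = S th.
Proof. by rewrite sin_acos//; have /andP[? ?] := rcos_bound th; rewrite !ltW. Qed.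

Lemma cosnS n th : cosn n.+1 th = r * cos th * cosn n th - S th ^+ 2 * sinn n th.
Proof.
rewrite /cosn /sinn -natr1 mulrDl mul1r cosD cos_phase sin_phaseE.
by field; exact: sin_phase_neq0.
Qed.

Lemma sinnS n th : sinn n.+1 th = r * cos th * sinn n th + cosn n th.
Proof.
rewrite /cosn /sinn -natr1 mulrDl mul1r sinD cos_phase sin_phaseE.
by field; exact: sin_phase_neq0.
Qed.

(** First row of [chi^2 phi = - S^2 phi], from [|B|^2 + (r sin th)^2 = S^2]; [chi_sqr2] is the
    second. *)
Let chi_sqr1 th : - (0 +i* (r * sin th))%C * chi1 th + B * expi (- th) * chi2 th =
  - ((S th ^+ 2)%:C)%C * alpha.
Proof.
have -> : ((S th ^+ 2)%:C)%C = B * conjc B + (((r * sin th) ^+ 2)%:C)%C.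
  rewrite BB -rmorphD /= sqr_sin_phase//; congr (_%:C)%C.
  by rewrite !exprMn sin2cos2; ring.
have iE : (0 +i* (r * sin th))%C * (0 +i* (r * sin th))%C = - (((r * sin th) ^+ 2)%:C)%C.
  by simpc; congr (_ +i* _)%C; ring.
have eE := expiNK th.
rewrite /chi1 /chi2; move: (expi th) (expi (- th)) (conjc B) eE iE => e e' B' eE.
move: ((0 +i* (r * sin th))%C) => I IE.
transitivity (I * I * alpha - (e * e') * (B * B') * alpha); first by ring.
by rewrite IE eE; ring.
Qed.

Let chi_sqr2 th : - (conjc B * expi th * chi1 th) + (0 +i* (r * sin th))%C * chi2 th =
  - ((S th ^+ 2)%:C)%C * beta.
Proof.
have -> : ((S th ^+ 2)%:C)%C = B * conjc B + (((r * sin th) ^+ 2)%:C)%C.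
  rewrite BB -rmorphD /= sqr_sin_phase//; congr (_%:C)%C.
  by rewrite !exprMn sin2cos2; ring.
have iE : (0 +i* (r * sin th))%C * (0 +i* (r * sin th))%C = - (((r * sin th) ^+ 2)%:C)%C.
  by simpc; congr (_ +i* _)%C; ring.
have eE := expiNK th.
rewrite /chi1 /chi2; move: (expi th) (expi (- th)) (conjc B) eE iE => e e' B' eE.
move: ((0 +i* (r * sin th))%C) => I IE.
transitivity (I * I * beta - (e * e') * (B * B') * beta); first by ring.
by rewrite IE eE; ring.
Qed.

Let r_expi th : (r%:C)%C * expi th = ((r * cos th)%:C)%C + (0 +i* (r * sin th))%C.
Proof. by rewrite /expi; simpc. Qed.

Let r_expiN th : (r%:C)%C * expi (- th) = ((r * cos th)%:C)%C - (0 +i* (r * sin th))%C.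
Proof. by rewrite /expi cosN sinN; simpc. Qed.

(** In the product of [cos om + chi] and [cosn n + sinn n * chi], replacing [chi^2] by [- S^2]
    reproduces the recurrences [cosnS] and [sinnS]. The window is fixed during the induction: at
    each step [n < M], so the amplitudes vanish at the sites affected by the shifts. *)
Lemma fourier_amp (M n : nat) (th : R) : (n <= M)%N ->
  fourier M (fun k => amp n k 0 0) th =
    expi eta ^+ n * (((cosn n th)%:C)%C * alpha + ((sinn n th)%:C)%C * chi1 th) /\
  fourier M (fun k => amp n k 1 0) th =
    expi eta ^+ n * (((cosn n th)%:C)%C * beta + ((sinn n th)%:C)%C * chi2 th).
Proof.
elim: n => [_|n IH nM].
  rewrite /cosn /sinn !mul0r cos0 sin0 mul0r !fourier_delta0.
  - by rewrite /= /qubit !mxE /= expr0; split; ring.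
  - by move=> k /negbTE /= ->; rewrite mxE.
  - by move=> k /negbTE /= ->; rewrite mxE.
have [IH1 IH2] := IH (ltnW nM).
have F0 : fourier M (fun k => amp n.+1 k 0 0) th =
    expi (- (th + kappa)) * (a * fourier M (fun k => amp n k 0 0) th
                             + b * fourier M (fun k => amp n k 1 0) th).
  rewrite -fourierD -fourier_shift.
  - by apply: eq_bigr => i _; rewrite qw_amp0.
  - by rewrite !qw_amp_support ?mulr0 ?addr0//; lia.
  - by rewrite !qw_amp_support ?mulr0 ?addr0//; lia.
have F1 : fourier M (fun k => amp n.+1 k 1 0) th =
    expi (th + kappa) * (c * fourier M (fun k => amp n k 0 0) th
                             + d * fourier M (fun k => amp n k 1 0) th).
  rewrite -fourierD -fourier_shiftN.
  - by apply: eq_bigr => i _; rewrite qw_amp1.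
  - by rewrite !qw_amp_support ?mulr0 ?addr0//; lia.
  - by rewrite !qw_amp_support ?mulr0 ?addr0//; lia.
have kk := expiNK kappa.
rewrite F0 F1 IH1 IH2 aE bE cE dE opprD !expiD exprS cosnS sinnS.
have s1 := chi_sqr1 th; have s2 := chi_sqr2 th.
have re := r_expi th; have reN := r_expiN th.
have x1E : chi1 th = - (0 +i* (r * sin th))%C * alpha + B * expi (- th) * beta by [].
have x2E : chi2 th = - (conjc B * expi th * alpha) + (0 +i* (r * sin th))%C * beta by [].
move: (chi1 th) (chi2 th) (cosn n th) (sinn n th) (S th ^+ 2) s1 s2 x1E x2E.
move=> x1 x2 cn0 sn0 T0 s1 s2 x1E x2E.
rewrite !(rmorphB, rmorphD, rmorphM) /= in s1 s2 re reN *.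
move: (cn0%:C)%C (sn0%:C)%C (T0%:C)%C s1 s2 => cn sn T s1 s2.
move: (expi th) (expi (- th)) (expi kappa) (expi (- kappa)) kk re reN s1 s2 x1E x2E.
move=> e e' k k' kk re reN s1 s2 x1E x2E.
move: ((0 +i* (r * sin th))%C) re reN s1 s2 x1E x2E => I re reN s1 s2 x1E x2E.
split.
- transitivity (expi eta ^+ n * expi eta * (k * k') *
    (r%:C%C * e' * (cn * alpha + sn * x1) + B * e' * (cn * beta + sn * x2))); first by ring.
  rewrite kk reN mulr1 (mulrC (expi eta ^+ n)); congr (_ * _).
  transitivity (cn * ((r%:C)%C * (cos th)%:C%C * alpha + (- I * alpha + B * e' * beta)) +
     sn * ((r%:C)%C * (cos th)%:C%C * x1 + (- I * x1 + B * e' * x2))); first by ring.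
  by rewrite s1 -x1E; ring.
- transitivity (expi eta ^+ n * expi eta * (k * k') *
    (- (conjc B * e * (cn * alpha + sn * x1)) + r%:C%C * e * (cn * beta + sn * x2))); first by ring.
  rewrite kk re mulr1 (mulrC (expi eta ^+ n)); congr (_ * _).
  transitivity (cn * ((r%:C)%C * (cos th)%:C%C * beta + (- (conjc B * e * alpha) + I * beta)) +
     sn * ((r%:C)%C * (cos th)%:C%C * x2 + (- (conjc B * e * x1) + I * x2))); first by ring.
  by rewrite s2 -x2E; ring.
Qed.

End closed_form.

(** Cauchy-Schwarz for unit vectors of [C^2], through [2 x y <= x^2 + y^2] in real coordinates. It
    gives both the domination of the Fourier integrals and [|l| r <= 1]. *)
Lemma hermitian_bound {R : realType} (z1 z2 w1 w2 : R[i]) :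
  complex.Re (conjc z1 * z1 + conjc z2 * z2) = 1 ->
  complex.Re (conjc w1 * w1 + conjc w2 * w2) = 1 ->
  `|complex.Re (conjc z1 * w1 + conjc z2 * w2)| <= 1 /\
  `|complex.Im (conjc z1 * w1 + conjc z2 * w2)| <= 1.
Proof.
case: z1 z2 w1 w2 => [a a'] [b b'] [c c'] [d d']; simpc => /= zE wE.
have q (x y : R) : 0 <= x ^+ 2 + y ^+ 2 + 2 * x * y /\ 0 <= x ^+ 2 + y ^+ 2 - 2 * x * y.
  by have := sqr_ge0 (x + y); have := sqr_ge0 (x - y) => ? ?; split; nra.
split; apply/ler_normlP; split.
- by have [? _] := q a c; have [? _] := q a' c'; have [? _] := q b d; have [? _] := q b' d'; nra.
- by have [_ ?] := q a c; have [_ ?] := q a' c'; have [_ ?] := q b d; have [_ ?] := q b' d'; nra.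
- by have [? _] := q a c'; have [_ ?] := q a' c; have [? _] := q b d'; have [_ ?] := q b' d; nra.
- by have [_ ?] := q a c'; have [? _] := q a' c; have [_ ?] := q b d'; have [? _] := q b' d; nra.
Qed.

Lemma continuous_cos_sin {R : realType} (p q : R) :
  continuous (fun x : R => p * cos x + q * sin x).
Proof.
by move=> x; apply: cvgD; apply: cvgMr; [exact: continuous_cos|exact: continuous_sin].
Qed.

(** * Inner products of states at neighbouring frequencies *)

Section overlap.
Context {R : realType}.
Notation C := R[i].
Notation Re := (@complex.Re R).
Notation Im := (@complex.Im R).
Variables (alpha beta : C) (r : R) (B : C).
Hypotheses (r0 : 0 < r) (r1 : r < 1)
  (BB : B * conjc B = ((1 - r ^+ 2)%:C)%C)
  (ab : cabs alpha ^+ 2 + cabs beta ^+ 2 = 1).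
Notation S := (sin_phase r).
Notation chi1 := (chi1 alpha beta r B).
Notation chi2 := (chi2 alpha beta r B).

Definition overlap (th th' : R) : C := conjc (chi1 th) * chi1 th' + conjc (chi2 th) * chi2 th'.

Definition drift (th : R) : R := Im (conjc alpha * chi1 th + conjc beta * chi2 th).

Let abC : conjc alpha * alpha + conjc beta * beta = 1.
Proof.
have : ((cabs alpha ^+ 2 + cabs beta ^+ 2)%:C)%C = 1 :> C by rewrite ab.
by rewrite rmorphD /= !sqr_cabs => <-; ring.
Qed.

Let continuous_chi : [/\ continuous (fun th => Re (chi1 th)), continuous (fun th => Im (chi1 th)),
  continuous (fun th => Re (chi2 th)) & continuous (fun th => Im (chi2 th))].
Proof.
(* Each part is a combination of [cos] and [sin], whose coefficients are its values at [0] and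
   [pi / 2]. *)
have trig (h : R -> R) : (forall x, h x = h 0 * cos x + h (pi / 2) * sin x) -> continuous h.
  by move=> H; rewrite (funext H); exact: continuous_cos_sin.
rewrite /chi1 /chi2 /expi; move: alpha beta B => [a1 a2] [b1 b2] [B1 B2].
split; apply: trig => x; simpc;
  rewrite /= ?cosN ?sinN cos0 sin0 cos_pihalf sin_pihalf; ring.
Qed.

Lemma continuous_drift : continuous drift.
Proof.
have [c1 c2 c3 c4] := continuous_chi.
have E th : drift th = Re alpha * Im (chi1 th) - Im alpha * Re (chi1 th) +
    (Re beta * Im (chi2 th) - Im beta * Re (chi2 th)).
  rewrite /drift; case: (chi1 th) => x1 x2; case: (chi2 th) => y1 y2.
  by case: alpha beta => [a1 a2] [b1 b2]; simpc => /=; ring.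
rewrite (funext E) => th.
by apply: cvgD; apply: cvgB; apply: cvgMr; [exact: c2|exact: c1|exact: c4|exact: c3].
Qed.

Lemma continuous_overlap th : continuous (fun t => Re (overlap th t)) /\
  continuous (fun t => Im (overlap th t)).
Proof.
have [c1 c2 c3 c4] := continuous_chi.
have E t : Re (overlap th t) = Re (chi1 th) * Re (chi1 t) + Im (chi1 th) * Im (chi1 t)
    + (Re (chi2 th) * Re (chi2 t) + Im (chi2 th) * Im (chi2 t)).
  rewrite /overlap; case: (chi1 th) (chi1 t) (chi2 th) (chi2 t) => [? ?] [? ?] [? ?] [? ?].
  by simpc => /=; ring.
have F t : Im (overlap th t) = Re (chi1 th) * Im (chi1 t) - Im (chi1 th) * Re (chi1 t)
    + (Re (chi2 th) * Im (chi2 t) - Im (chi2 th) * Re (chi2 t)).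
  rewrite /overlap; case: (chi1 th) (chi1 t) (chi2 th) (chi2 t) => [? ?] [? ?] [? ?] [? ?].
  by simpc => /=; ring.
rewrite (funext E) (funext F); split=> t.
- by apply: cvgD; apply: cvgD; apply: cvgMr; [exact: c1|exact: c2|exact: c3|exact: c4].
- by apply: cvgD; apply: cvgB; apply: cvgMr; [exact: c2|exact: c1|exact: c4|exact: c3].
Qed.

(** [chi] is skew-hermitian with square [- S^2], so it stretches the unit vector [phi] by exactly
    [S]. *)
Lemma overlap_diag th : overlap th th = ((S th ^+ 2)%:C)%C.
Proof.
have SE : ((S th ^+ 2)%:C)%C = B * conjc B + (((r * sin th) ^+ 2)%:C)%C.
  rewrite BB -rmorphD /= sqr_sin_phase//; congr (_%:C)%C.
  by rewrite !exprMn sin2cos2; ring.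
have iE : (0 +i* (r * sin th))%C * (0 +i* (r * sin th))%C = - (((r * sin th) ^+ 2)%:C)%C.
  by simpc; congr (_ +i* _)%C; ring.
have cI : conjc (0 +i* (r * sin th))%C = - (0 +i* (r * sin th))%C by simpc.
have eE := expiNK th.
rewrite /overlap /chi1 /chi2 SE.
rewrite !(conjcD, conjcN, conjcM) !conj_expi cI !opprK conjcK.
move: (expi th) (expi (- th)) (conjc B) eE iE => e e' B' eE.
move: ((0 +i* (r * sin th))%C) (((r * sin th) ^+ 2)%:C)%C {cI} => I J IE.
move: (conjc alpha) (conjc beta) abC => a' b' aE.
transitivity ((- (I * I) + e * e' * (B * B')) * (a' * alpha + b' * beta)); first by ring.
by rewrite IE eE aE; ring.
Qed.

(** A skew-hermitian form takes imaginary values; this is why the drift enters [corr_im] but not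
    [corr_re]. *)
Lemma drift_real th : conjc alpha * chi1 th + conjc beta * chi2 th = (0 +i* drift th)%C.
Proof.
suff : Re (conjc alpha * chi1 th + conjc beta * chi2 th) = 0.
  by rewrite /drift; case: (_ + _) => x y /= ->.
rewrite /chi1 /chi2 /expi cosN sinN.
by case: alpha beta B => [a1 a2] [b1 b2] [B1 B2]; simpc => /=; ring.
Qed.

Section law.
Variables (a b c d : C) (eta kappa : R).
Hypotheses (aE : a = expi eta * (r%:C)%C * expi kappa) (bE : b = expi eta * expi kappa * B)
  (cE : c = - (expi eta * expi (- kappa) * conjc B))
  (dE : d = expi eta * (r%:C)%C * expi (- kappa)).
Notation amp := (qw_amp a b c d alpha beta).
Notation prob := (qw_prob a b c d alpha beta).
Notation left n := (fourier kappa n (fun k => amp n k 0 0)).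
Notation right n := (fourier kappa n (fun k => amp n k 1 0)).
Notation period := ([set` `[- (pi / 2) : R, pi / 2 + pi]]).

(** With [corr_im], the real and imaginary parts of the inner product of the states at [th] and
    [th + h], expanded by the closed form. *)
Definition corr_re n h th : R := cosn r n th * cosn r n (th + h)
  + sinn r n th * sinn r n (th + h) * Re (overlap th (th + h)).
Definition corr_im n h th : R := cosn r n th * sinn r n (th + h) * drift (th + h)
  - sinn r n th * cosn r n (th + h) * drift th
  + sinn r n th * sinn r n (th + h) * Im (overlap th (th + h)).

Let corrE n h th : conjc (left n th) * left n (th + h) + conjc (right n th) * right n (th + h)
  = (corr_re n h th +i* corr_im n h th)%C.
Proof.
have F t := fourier_amp _ _ _ _ alpha beta _ _ _ _ r0 r1 BB aE bE cE dE n n t (leqnn n).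
have [-> ->] := F th; have [-> ->] := F (th + h).
have uu : conjc (expi eta ^+ n) * expi eta ^+ n = 1.
  by rewrite conjcX conj_expi -exprMn mulrC expiNK expr1n.
have D1 := drift_real th; have D2 := drift_real (th + h).
have O : overlap th (th + h) =
  conjc (chi1 th) * chi1 (th + h) + conjc (chi2 th) * chi2 (th + h) by [].
rewrite /corr_re /corr_im.
move: (chi1 th) (chi2 th) (chi1 (th + h)) (chi2 (th + h)) D1 D2 O => x1 x2 y1 y2 D1 D2 O.
have D1' : alpha * conjc x1 + beta * conjc x2 = (0 +i* - drift th)%C.
  by have := congr1 conjc D1; rewrite !(conjcM, conjcD) !conjcK.
rewrite !(conjcM, conjcD) !conjc_real.
move: (cosn r n th) (cosn r n (th + h)) (sinn r n th) (sinn r n (th + h)) => p p' q q'.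
transitivity ((p%:C)%C * (p'%:C)%C * (conjc alpha * alpha + conjc beta * beta) +
   (p%:C)%C * (q'%:C)%C * (conjc alpha * y1 + conjc beta * y2) +
   (q%:C)%C * (p'%:C)%C * (alpha * conjc x1 + beta * conjc x2) +
   (q%:C)%C * (q'%:C)%C * overlap th (th + h)).
  rewrite O; move: uu; move: (conjc (expi eta ^+ n)) (expi eta ^+ n) => u u' uu.
  rewrite -[RHS]mul1r -uu; ring.
rewrite abC D2 D1'; move: (overlap th (th + h)) => [w1 w2].
by simpc; congr (_ +i* _)%C => /=; ring.
Qed.

(** [corrE] at [h = 0] shows that the states are unit vectors. *)
Let corr_bound n h th : `|corr_re n h th| <= 1 /\ `|corr_im n h th| <= 1.
Proof.
have N t : Re (conjc (left n t) * left n t + conjc (right n t) * right n t) = 1.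
  have := corrE n 0 t; rewrite addr0 => ->.
  rewrite /corr_re addr0 overlap_diag /= /cosn /sinn.
  rewrite -[RHS](cos2Dsin2 (n%:R * phase r t)).
  by field; exact: sin_phase_neq0.
by have := hermitian_bound _ _ _ _ (N th) (N (th + h)); rewrite corrE.
Qed.

Let left_trig n th h : left n (th + h) = \sum_(0 <= i < (2 * n).+1)
  (amp n (site n i) 0 0 * expi ((site n i)%:~R * (kappa + h))) * expi ((site n i)%:~R * th).
Proof.
rewrite /fourier; apply: eq_bigr => i _; rewrite -mulrA -expiD.
by congr (_ * expi _); ring.
Qed.

Let right_trig n th h : right n (th + h) = \sum_(0 <= i < (2 * n).+1)
  (amp n (site n i) 1 0 * expi ((site n i)%:~R * (kappa + h))) * expi ((site n i)%:~R * th).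
Proof.
rewrite /fourier; apply: eq_bigr => i _; rewrite -mulrA -expiD.
by congr (_ * expi _); ring.
Qed.

Let site_inj n : injective (site n).
Proof. by move=> i j; rewrite /site; lia. Qed.

Let probE n k : ((prob n k)%:C)%C =
  conjc (amp n k 0 0) * amp n k 0 0 + conjc (amp n k 1 0) * amp n k 1 0.
Proof.
rewrite /qw_prob big_ord_recr big_ord1 /= rmorphD /= !sqr_cabs.
by congr (_ + _); rewrite mulrC //; congr (conjc (amp _ _ _ _) * amp _ _ _ _);
  exact/val_inj.
Qed.

Let coef n h (j : 'I_2) i : C := amp n (site n i) j 0 * expi ((site n i)%:~R * (kappa + h)).

Let pairing n h (e : C) (j : 'I_2) th : R :=
  Re (conjc (\sum_(0 <= i < (2 * n).+1) coef n 0 j i * expi ((site n i)%:~R * th)) *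
      (\sum_(0 <= i < (2 * n).+1) (e * coef n h j i) * expi ((site n i)%:~R * th))).

Let twist n h (e : C) th :
  Re (e * (conjc (left n th) * left n (th + h) + conjc (right n th) * right n (th + h))) =
  pairing n h e 0 th + pairing n h e 1 th.
Proof.
rewrite -raddfD /=; congr Re.
have -> : left n th = left n (th + 0) by rewrite addr0.
have -> : right n th = right n (th + 0) by rewrite addr0.
rewrite !left_trig !right_trig mulrDr.
by congr (_ + _); rewrite mulrCA mulr_sumr; congr (_ * _); apply: eq_bigr => i _;
  rewrite /coef; ring.
Qed.

Let continuous_twist n h e : continuous (fun th =>
  Re (e * (conjc (left n th) * left n (th + h) + conjc (right n th) * right n (th + h)))).
Proof.
rewrite (funext (twist n h e)) => th.
by apply: cvgD; apply: (continuous_parseval _ _ _ _).1.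
Qed.

(** Parseval at each of the two components: the phases in [kappa] cancel and those in [h] remain.
    The scalar [e] selects the transform, [1] for cosines and [- i] for sines. *)
Let integral_twist n h (e : C) :
  \int[lebesgue_measure]_(th in period)
    Re (e * (conjc (left n th) * left n (th + h) + conjc (right n th) * right n (th + h)))
  = pi *+ 2 * \sum_(0 <= i < (2 * n).+1) prob n (site n i) * Re (e * expi ((site n i)%:~R * h)).
Proof.
have P j := continuous_parseval (2 * n).+1 (site n) (coef n 0 j) (fun i => e * coef n h j i).
transitivity (1 * \int[lebesgue_measure]_(th in period) pairing n h e 0 th +
              1 * \int[lebesgue_measure]_(th in period) pairing n h e 1 th).
  rewrite -Rintegral_linear; [|exact: (P _).1|exact: (P _).1].
  by apply: eq_Rintegral => x _; rewrite !mul1r twist.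
rewrite !(P _).2; try exact: site_inj.
rewrite !mul1r -mulrDr -big_split /=; congr (_ * _); apply: eq_bigr => i _.
rewrite /coef addr0.
transitivity (Re ((prob n (site n i))%:C%C * (e * expi ((site n i)%:~R * h)))); last first.
  by case: (e * _) => x y; simpc.
rewrite -raddfD probE; congr Re.
rewrite !conjcM !conj_expi mulrDr expiD.
have := expiNK ((site n i)%:~R * kappa).
move: (expi (_ * kappa)) (expi (- _)) => k k' kk.
transitivity (k * k' * (conjc (amp n (site n i) 0 0) * amp n (site n i) 0 0 +
   conjc (amp n (site n i) 1 0) * amp n (site n i) 1 0) * (e * expi ((site n i)%:~R * h))).
  by ring.
by rewrite kk mul1r.
Qed.

Let pi2_neq0 : pi *+ 2 != 0 :> R.
Proof. by rewrite mulrn_eq0 /= gt_eqF// pi_gt0. Qed.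

Lemma qw_char_cos n h : continuous (corr_re n h) /\ (forall th, `|corr_re n h th| <= 1) /\
  \sum_(0 <= i < (2 * n).+1) prob n (site n i) * cos ((site n i)%:~R * h) =
  (pi *+ 2)^-1 * \int[lebesgue_measure]_(th in period) corr_re n h th.
Proof.
have E th : corr_re n h th =
   Re (1 * (conjc (left n th) * left n (th + h) + conjc (right n th) * right n (th + h))).
  by rewrite corrE mul1r.
split; first by rewrite (funext E); exact: continuous_twist.
split; first by move=> th; have [] := corr_bound n h th.
under eq_Rintegral do rewrite E.
rewrite integral_twist mulKf ?pi2_neq0//.
by apply: eq_bigr => i _; rewrite mul1r.
Qed.

Lemma qw_char_sin n h : continuous (corr_im n h) /\ (forall th, `|corr_im n h th| <= 1) /\
  \sum_(0 <= i < (2 * n).+1) prob n (site n i) * sin ((site n i)%:~R * h) =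
  (pi *+ 2)^-1 * \int[lebesgue_measure]_(th in period) corr_im n h th.
Proof.
have E th : corr_im n h th =
   Re ((0 -i* 1)%C *
    (conjc (left n th) * left n (th + h) + conjc (right n th) * right n (th + h))).
  by rewrite corrE; simpc => /=.
split; first by rewrite (funext E); exact: continuous_twist.
split; first by move=> th; have [] := corr_bound n h th.
under eq_Rintegral do rewrite E.
rewrite integral_twist mulKf ?pi2_neq0//.
by apply: eq_bigr => i _; rewrite /expi; simpc => /=.
Qed.

End law.
End overlap.

(** * The limit law *)

Lemma Rintegral_bounded_cvg {R : realType} (h_ : nat -> R -> R) (h : R -> R) (M a b : R) :
  (forall n, continuous (h_ n)) -> continuous h ->
  (forall n x, `|h_ n x| <= M) -> (forall x : R, (fun n => h_ n x) @ \oo --> h x) ->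
  (fun n => \int[lebesgue_measure]_(x in `[a, b]) h_ n x) @ \oo -->
     \int[lebesgue_measure]_(x in `[a, b]) h x.
Proof.
move=> ch_ ch hM hh.
have mc (g : R -> R) : continuous g ->
    measurable_fun (`[a, b]%classic : set R) (EFin \o g).
  move=> cg; apply/measurable_EFinP; apply: measurable_funTS.
  exact: continuous_measurable_fun.
have [||||||ih _ H] := @dominated_convergence _ _ R (@lebesgue_measure R) `[a, b]%classic _
  (fun n x => (h_ n x)%:E) (fun x => (h x)%:E) (fun=> M%:E).
- by [].
- by move=> n; exact: mc.
- exact: mc.
- by apply/aeW => x _; apply: cvg_EFin; [exact: nearW|exact: hh].
- apply: (@integrable_itv_continuous _ (fun=> M)) => x; exact: cvg_cst.
- by apply/aeW => x n _; rewrite lee_fin.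
apply: fine_cvg; rewrite fineK; first exact: H.
exact: integrable_fin_num.
Qed.

Lemma Rintegral_half_period {R : realType} (h : R -> R) : continuous h ->
  (forall x, h (x + pi) = h x) ->
  \int[lebesgue_measure]_(x in `[- (pi / 2), pi / 2 + pi]) h x =
  2 * \int[lebesgue_measure]_(x in `[- (pi / 2), pi / 2]) h x.
Proof.
move=> ch hp.
have p0 := pi_gt0 R.
have i1 : - (pi / 2) <= pi / 2 :> R by lra.
have i2 : pi / 2 <= pi / 2 + pi :> R by lra.
have ih a b := integrable_itv_continuous h a b ch.
have shift : \int[lebesgue_measure]_(x in `[- (pi / 2) + pi, pi / 2 + pi]) h x =
    \int[lebesgue_measure]_(x in `[- (pi / 2), pi / 2]) h x.
  have dF (x : R) : is_derive x 1 (fun y : R => y + pi) 1.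
    have -> : (fun y : R => y + pi) = id + cst pi by apply/funext.
    by apply: is_derive_eq; rewrite addr0.
  have dFE : derive1 (fun y : R => y + pi) = cst 1.
    by apply/funext => x; have H := dF x; rewrite derive1E derive_val.
  have cF : continuous (fun y : R => y + pi).
    by move=> x; exact: is_derive_continuous (dF x).
  rewrite /Rintegral
    (@integration_by_substitution_increasing R (fun y => y + pi) h (- (pi / 2)) (pi / 2)).
  - congr fine; apply: eq_integral => x _; congr EFin.
    by rewrite dFE /= fctE /= mulr1 hp.
  - exact: i1.
  - by move=> x y _ _ xy; rewrite ltrD2r.
  - by move=> x _; rewrite dFE; exact: cvg_cst.
  - by rewrite dFE; exact: is_cvg_cst.
  - by rewrite dFE; exact: is_cvg_cst.
  - split=> [x _| |]; first by have [] := dF x.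
    + exact/cvg_at_right_filter/cF.
    + exact/cvg_at_left_filter/cF.
  - exact: continuous_subspaceT.
have E : - (pi / 2) + pi = pi / 2 :> R by field.
rewrite E in shift.
have := @Rintegral_itvB R h (BLeft (- (pi / 2))) (BRight (pi / 2 + pi)) (pi / 2) (ih _ _).
rewrite !bnd_simp => H.
have := H i1 i2.
have ioc : lebesgue_measure.-integrable `]pi / 2, pi / 2 + pi] (EFin \o h).
  apply: integrableS (ih (pi / 2) (pi / 2 + pi)) => //.
  by move=> x /=; rewrite !in_itv /= => /andP[/ltW -> ->].
rewrite (Rintegral_itv_obnd_cbnd ioc).
rewrite shift => /eqP; rewrite subr_eq => /eqP ->.
by rewrite mulr_natl mulr2n.
Qed.

Lemma cvgn_div0 {R : realType} (xi : R) : (fun n : nat => xi / n%:R) @ \oo --> (0 : R).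
Proof.
rewrite -cvg_shiftS /=.
have : (fun n : nat => xi * n.+1%:R^-1) @ \oo --> xi * (0 : R).
  by apply: cvgMr; exact: cvg_harmonic.
by rewrite mulr0.
Qed.

Lemma cvg_bounded_mul0 {R : realType} (b_ x_ : nat -> R) : (forall n, `|b_ n| <= 1) ->
  x_ @ \oo --> (0 : R) -> (fun n => b_ n * x_ n) @ \oo --> (0 : R).
Proof.
move=> b1 x0; apply/cvgr0Pnorm_le => e e0.
near=> n; rewrite normrM; apply: (@le_trans _ _ (1 * `|x_ n|)).
  exact: ler_wpM2r.
rewrite mul1r; near: n; exact: cvgr0_norm_le.
Unshelve. all: by end_near. Qed.

(** The derivative is a limit along nonzero increments, so [xi = 0] is separate and the sequence is
    shifted past [n = 0]. *)
Lemma cvg_diff_quotient {R : realType} (f : R -> R) (x df xi : R) : is_derive x 1 f df ->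
  (fun n : nat => n%:R * (f (x + xi / n%:R) - f x)) @ \oo --> xi * df.
Proof.
move=> [ex dE]; have [->|xi0] := eqVneq xi 0.
  rewrite mul0r; under eq_fun do rewrite mul0r addr0 subrr mulr0.
  exact: cvg_cst.
have D : h^-1 *: (f (h *: 1 + x) - f x) @[h --> 0^'] --> df.
  by rewrite -dE; exact: ex.
have /cvgr_dnbhsP /(_ (fun n => xi / n.+1%:R)) := D.
have u0 (n : nat) : xi / n.+1%:R != 0 by rewrite mulf_neq0// invr_eq0.
have uc : (fun n : nat => xi / n.+1%:R) @ \oo --> (0 : R).
  by have := cvgn_div0 xi; rewrite -cvg_shiftS.
move=> /(_ (conj u0 uc)) H.
rewrite -cvg_shiftS /=.
have -> : (fun n : nat => n.+1%:R * (f (x + xi / n.+1%:R) - f x)) =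
  (fun n : nat => xi * ((xi / n.+1%:R)^-1 *: (f ((xi / n.+1%:R) *: 1 + x) - f x))).
  apply/funext => n; rewrite /GRing.scale /= mulr1 (addrC x).
  have : n.+1%:R != 0 :> R by rewrite pnatr_eq0.
  by move: (n.+1%:R) => m m0; field; rewrite xi0 m0.
by apply: cvgMr; exact: H.
Qed.

(** * Limits of the characteristic functions of the walk *)

Section limit_law.
Context {R : realType}.
Notation C := R[i].
Variables (a b c d alpha beta : C).
Hypotheses (U : unitary2 a b c d) (nz : a * b * c * d != 0)
  (ab : cabs alpha ^+ 2 + cabs beta ^+ 2 = 1).
Notation r := (cabs a).
Notation l := (qw_lambda a b alpha beta).
Notation S := (sin_phase r).
Notation v := (group_speed r).
Notation D := ([set` `[- (pi / 2) : R, pi / 2]]).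
Notation period := ([set` `[- (pi / 2) : R, pi / 2 + pi]]).
Notation prob := (qw_prob a b c d alpha beta).
Notation f := (konno_density r l).

Let r01 : 0 < r < 1.
Proof. by have [? [? [? []]]] := unitary2_polar _ _ _ _ U nz. Qed.
Let r0 : 0 < r. Proof. by case/andP: r01. Qed.
Let r1 : r < 1. Proof. by case/andP: r01. Qed.

Let B : C := b * conjc a / (r%:C)%C.

Let BB : B * conjc B = ((1 - r ^+ 2)%:C)%C.
Proof. by have [eta [kappa [B' [_ [H E] _ _]]]] := unitary2_polar _ _ _ _ U nz; rewrite /B -E. Qed.

Let mu : R := 2 * complex.Im (B * conjc alpha * beta).

(** Divided by [S], the first term is [- l v]: this is where [lambda] comes from. The second will
    integrate to 0 by parity. *)
Let driftE th : drift alpha beta r B th = - l * (r * sin th) + mu * cos th.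
Proof.
have rn : r != 0 by rewrite gt_eqF.
have lE : l = cabs alpha ^+ 2 - cabs beta ^+ 2 + 2 * complex.Re (B * conjc alpha * beta) / r.
  rewrite /qw_lambda; congr (_ + _).
  rewrite /B; have -> : ((r ^+ 2)%:C)%C = (r%:C)%C * (r%:C)%C by rewrite -rmorphM expr2.
  have rc : (r%:C)%C != 0 :> C by apply/eqP => /complexI/eqP; rewrite (negbTE rn).
  have -> : (a * alpha * (b * beta)^* + (a * alpha)^* * (b * beta))%C / ((r%:C)%C * (r%:C)%C) =
     (conjc (b * conjc a / (r%:C)%C * conjc alpha * beta) +
      b * conjc a / (r%:C)%C * conjc alpha * beta) * ((r^-1)%:C)%C.
    rewrite !conjcM conjcK conjc_inv conjc_real conjcK fmorphV.
    by field.
  by case: (_ * beta) => x y; simpc => /=; field.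
have cE (z : C) : cabs z ^+ 2 = complex.Re z ^+ 2 + complex.Im z ^+ 2.
  have := sqr_cabs z; case: z => x y; simpc => -[-> _] /=; ring.
rewrite lE !cE /drift /mu /chi1 /chi2 /expi cosN sinN.
move: rn; move: (B) (cabs a) (cos th) (sin th) alpha beta => [B1 B2] q x y [a1 a2] [b1 b2] qn.
by simpc => /=; field.
Qed.

(** At [th = pi / 2] the drift is [- l r] and [S = 1], so [chi phi] is a unit vector and
    Cauchy-Schwarz with [phi] applies. *)
Let lr : `|l| * r <= 1.
Proof.
have [] := hermitian_bound alpha beta (chi1 alpha beta r B (pi / 2)) (chi2 alpha beta r B (pi / 2)).
- have : ((cabs alpha ^+ 2 + cabs beta ^+ 2)%:C)%C = 1 :> C by rewrite ab.
  rewrite rmorphD /= !sqr_cabs (mulrC alpha) (mulrC beta) => ->.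
  by [].
- have := overlap_diag alpha beta r B r0 r1 BB ab (pi / 2); rewrite /overlap => ->.
  by rewrite sqr_sin_phase// cos_pihalf mulr0 expr0n subr0.
move=> _; have := driftE (pi / 2); rewrite /drift => ->.
by rewrite cos_pihalf sin_pihalf mulr0 addr0 mulr1 normrM normrN (ger0_norm (ltW r0)).
Qed.

Lemma limit_law_params : [/\ 0 < r, r < 1 & `|l| * r <= 1].
Proof. by []. Qed.

Let is_derive_phase (th : R) : is_derive th 1 (phase r) (v th).
Proof.
have H := is_derive1_acos (rcos_bound r r0 r1 th).
have E : is_derive th 1 (fun y => r * cos y) (- (r * sin th)).
  have -> : (fun y => r * cos y) = r \*: cos by apply/funext.
  by apply: is_derive_eq; rewrite /GRing.scale /= mulrN.
have := @is_derive1_comp R acos (fun y => r * cos y) th _ _ H E.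
by rewrite mulrNN mulrC.
Qed.

Let cvg_th xi (th : R) : (fun n : nat => th + xi / n%:R) @ \oo --> th.
Proof. by rewrite -[X in _ --> X]addr0; apply: cvgD; [exact: cvg_cst|exact: cvgn_div0]. Qed.

Let cvg_cont (h : R -> R) xi (th : R) : continuous h ->
  (fun n : nat => h (th + xi / n%:R)) @ \oo --> h th.
Proof. by move=> ch; apply: (continuous_cvg _ (ch th)); exact: cvg_th. Qed.

Let cvg_phase xi th :
  (fun n : nat => n%:R * phase r (th + xi / n%:R) - n%:R * phase r th) @ \oo --> xi * v th.
Proof.
have := @cvg_diff_quotient R (phase r) th (v th) xi (is_derive_phase th).
by under eq_fun do rewrite mulrBr.
Qed.

Let norm_sin_mul_le1 (x y : R) : `|sin x * sin y| <= 1.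
Proof. by rewrite normrM -[leRHS]mulr1 ler_pM// sin_max. Qed.

Let cS := continuous_sin_phase r r0 r1.
Let Sn th : S th != 0 := sin_phase_neq0 r r0 r1 th.

(** The phases [n om] need not converge separately; their difference between [th + xi / n] and [th]
    tends to [xi v]. Once it is isolated, what still oscillates is bounded and multiplies a factor
    tending to 0, because the overlap on the diagonal is [S^2]. *)
Let cvg_corr_re xi (th : R) :
  (fun n : nat => corr_re alpha beta r B n (xi / n%:R) th) @ \oo --> cos (xi * v th).
Proof.
pose w t := complex.Re (overlap alpha beta r B th t).
have -> : (fun n : nat => corr_re alpha beta r B n (xi / n%:R) th) = (fun n : nat =>
    cos (n%:R * phase r (th + xi / n%:R) - n%:R * phase r th) +
    sin (n%:R * phase r th) * sin (n%:R * phase r (th + xi / n%:R)) *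
      (w (th + xi / n%:R) / (S th * S (th + xi / n%:R)) - 1)).
  apply/funext => n; rewrite /corr_re /cosn /sinn cosB -/(w _).
  by field; rewrite !Sn.
rewrite -[X in _ --> X]addr0; apply: cvgD.
  by apply: cvg_comp (cvg_phase xi th) _; exact: continuous_cos.
apply: cvg_bounded_mul0; first by move=> n; exact: norm_sin_mul_le1.
rewrite -[X in _ --> X](subrr (1 : R)); apply: cvgB; last exact: cvg_cst.
have w1 : w th / (S th * S th) = 1.
  by rewrite /w overlap_diag//= expr2 divff// mulf_neq0.
rewrite -[X in _ --> X]w1; apply: cvgM; first by apply: (cvg_cont w); exact: (continuous_overlap alpha beta r B th).1.
apply: cvgV; first by rewrite mulf_neq0.
by apply: cvgMr; exact: cvg_cont.
Qed.

(** As for [corr_re], with two remainders: the variation of [drift / S] over a step [xi / n], and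
    the imaginary part of the overlap, which is 0 on the diagonal. *)
Let cvg_corr_im xi (th : R) :
  (fun n : nat => corr_im alpha beta r B n (xi / n%:R) th) @ \oo -->
     drift alpha beta r B th / S th * sin (xi * v th).
Proof.
pose w t := complex.Im (overlap alpha beta r B th t).
pose m t := drift alpha beta r B t.
have cm : continuous m by exact: continuous_drift.
have -> : (fun n : nat => corr_im alpha beta r B n (xi / n%:R) th) = (fun n : nat =>
    m th / S th * sin (n%:R * phase r (th + xi / n%:R) - n%:R * phase r th) +
    (cos (n%:R * phase r th) * sin (n%:R * phase r (th + xi / n%:R)) *
      (m (th + xi / n%:R) / S (th + xi / n%:R) - m th / S th) +
    sin (n%:R * phase r th) * sin (n%:R * phase r (th + xi / n%:R)) *
      (w (th + xi / n%:R) / (S th * S (th + xi / n%:R))))).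
  apply/funext => n; rewrite /corr_im /cosn /sinn sinB -/(w _) -/(m _) -/(m _).
  by field; rewrite !Sn.
rewrite -[X in _ --> X]addr0; apply: cvgD.
  by apply: cvgMr; apply: cvg_comp (cvg_phase xi th) _; exact: continuous_sin.
rewrite -[X in _ --> X](addr0 (0 : R)); apply: cvgD.
  apply: cvg_bounded_mul0.
    by move=> n; rewrite normrM -[leRHS]mulr1 ler_pM// ?sin_max ?cos_max.
  rewrite -[X in _ --> X](subrr (m th / S th)); apply: cvgB; last exact: cvg_cst.
  by apply: cvgM; [exact: cvg_cont|apply: cvgV => //; exact: cvg_cont].
apply: cvg_bounded_mul0; first by move=> n; exact: norm_sin_mul_le1.
have w0 : w th / (S th * S th) = 0.
  by rewrite /w overlap_diag//= mul0r.
rewrite -[X in _ --> X]w0; apply: cvgM; first by apply: (cvg_cont w); exact: (continuous_overlap alpha beta r B th).2.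
apply: cvgV; first by rewrite mulf_neq0.
by apply: cvgMr; exact: cvg_cont.
Qed.

Let expect n (g : R -> R) := \sum_(0 <= i < (2 * n).+1)
  prob n (site n i) * g ((site n i)%:~R / n%:R).

Let cv := continuous_group_speed r r0 r1.

Let continuous_comp_v (h : R -> R) xi : continuous h -> continuous (fun th => h (xi * v th)).
Proof.
move=> ch x; apply: (@continuous_comp _ _ _ (fun y : R => xi * v y) h); last exact: ch.
by apply: cvgMr; exact: cv.
Qed.

Let vDpi th : v (th + pi) = - v th.
Proof. by rewrite /group_speed /sin_phase cosDpi sinDpi !mulrN sqrrN mulNr. Qed.

Let SDpi th : S (th + pi) = S th.
Proof. by rewrite /sin_phase cosDpi mulrN sqrrN. Qed.

Let half_pi2 (x : R) : (pi *+ 2)^-1 * (2 * x) = pi^-1 * x.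
Proof.
have : pi != 0 :> R by rewrite gt_eqF// pi_gt0.
by rewrite -mulr_natl; move: (@pi R) => p pn; field.
Qed.

(** [v] changes sign under [th + pi], so the limit integrand has period [pi] and its average may be
    taken over [[- (pi / 2), pi / 2]]. *)
Lemma cvg_expect_cos xi : (fun n => expect n (fun x => cos (xi * x))) @ \oo -->
  \int[lebesgue_measure]_x (cos (xi * x) * f x).
Proof.
have [eta [kappa [B' [_ [_ E] [aE bE] [cE dE]]]]] := unitary2_polar _ _ _ _ U nz.
rewrite E -/B in bE cE.
have Q n h := qw_char_cos alpha beta r B r0 r1 BB ab a b c d eta kappa aE bE cE dE n h.
have -> : (fun n => expect n (fun x => cos (xi * x))) = (fun n : nat =>
   (pi *+ 2)^-1 *
   \int[lebesgue_measure]_(th in period) corr_re alpha beta r B n (xi / n%:R) th).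
  apply/funext => n; have [_ [_ <-]] := Q n (xi / n%:R).
  by apply: eq_bigr => i _; congr (_ * cos _); ring.
have cc := continuous_comp_v _ xi (@continuous_cos R).
rewrite integral_konno_cos// -half_pi2 -Rintegral_half_period//; last first.
  by move=> x; rewrite vDpi mulrN cosN.
apply: cvgMr; apply: (Rintegral_bounded_cvg _ _ 1 _ _ _ _ _ (cvg_corr_re xi)) => //.
- by move=> n; have [] := Q n (xi / n%:R).
- by move=> n x; have [_ []] := Q n (xi / n%:R).
Qed.

Lemma cvg_expect_sin xi : (fun n => expect n (fun x => sin (xi * x))) @ \oo -->
  \int[lebesgue_measure]_x (sin (xi * x) * f x).
Proof.
have [eta [kappa [B' [_ [_ E] [aE bE] [cE dE]]]]] := unitary2_polar _ _ _ _ U nz.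
rewrite E -/B in bE cE.
have Q n h := qw_char_sin alpha beta r B r0 r1 BB ab a b c d eta kappa aE bE cE dE n h.
have -> : (fun n => expect n (fun x => sin (xi * x))) = (fun n : nat =>
   (pi *+ 2)^-1 *
   \int[lebesgue_measure]_(th in period) corr_im alpha beta r B n (xi / n%:R) th).
  apply/funext => n; have [_ [_ <-]] := Q n (xi / n%:R).
  by apply: eq_bigr => i _; congr (_ * sin _); ring.
pose h th := drift alpha beta r B th / S th * sin (xi * v th).
have cs := continuous_comp_v _ xi (@continuous_sin R).
have ch : continuous h.
  move=> x; apply: cvgM; last exact: cs.
  apply: cvgM; first exact: continuous_drift.
  by apply: cvgV; [exact: Sn|exact: cS].
pose k1 th := v th * sin (xi * v th).
have ck1 : continuous k1 by move=> x; apply: cvgM; [exact: cv|exact: cs].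
pose k2 th := cos th / S th * sin (xi * v th).
have ck2 : continuous k2.
  move=> x; apply: cvgM; last exact: cs.
  by apply: cvgM; [exact: continuous_cos|apply: cvgV; [exact: Sn|exact: cS]].
have hE : \int[lebesgue_measure]_(th in D) h th =
    \int[lebesgue_measure]_(th in D) (- l * (v th * sin (xi * v th))).
  transitivity (- l * \int[lebesgue_measure]_(th in D) k1 th +
                mu * \int[lebesgue_measure]_(th in D) k2 th).
    rewrite -Rintegral_linear//; apply: eq_Rintegral => th _.
    by rewrite /h driftE /k1 /k2 /group_speed; field; exact: Sn.
  (* [cos / S] is even and [sin (xi v)] is odd, so the [mu] part disappears. *)
  rewrite (integral_odd k2) ?mulr0 ?addr0//.
  - by rewrite RintegralZl//; exact: integrable_itv_continuous.
  - by rewrite divr_ge0 ?pi_ge0.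
  - by move=> x; rewrite /k2 /sin_phase group_speedN cosN mulrN sinN mulrN.
rewrite integral_konno_sin// -hE -half_pi2 -Rintegral_half_period//; last first.
  move=> x; rewrite /h vDpi SDpi mulrN sinN !driftE sinDpi cosDpi; field; exact: Sn.
apply: cvgMr; apply: (Rintegral_bounded_cvg _ _ 1 _ _ _ _ _ (cvg_corr_im xi)) => //.
- by move=> n; have [] := Q n (xi / n%:R).
- by move=> n x; have [_ []] := Q n (xi / n%:R).
Qed.

(** The characteristic function at 0, where [corr_re] is the squared norm of a unit state. *)
Lemma qw_prob_sum n : \sum_(0 <= i < (2 * n).+1) prob n (site n i) = 1.
Proof.
have [eta [kappa [B' [_ [_ E] [aE bE] [cE dE]]]]] := unitary2_polar _ _ _ _ U nz.
rewrite E -/B in bE cE.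
have [_ [_]] := qw_char_cos alpha beta r B r0 r1 BB ab a b c d eta kappa aE bE cE dE n 0.
under eq_bigr do rewrite mulr0 cos0 mulr1.
move=> ->; under eq_Rintegral => th _.
  rewrite /corr_re addr0 overlap_diag// (_ : _ + _ = 1); last first.
    rewrite /= /cosn /sinn -[RHS](cos2Dsin2 (n%:R * phase r th)).
    by field; exact: Sn.
  over.
rewrite (@Rintegral_is_derive R (fun=> 1) id) //.
- have : pi != 0 :> R by rewrite gt_eqF// pi_gt0.
  by rewrite -mulr_natl; move: (@pi R) => p pn; field.
- by have := pi_gt0 R; lra.
- by move=> x; exact: cvg_cst.
Qed.

Lemma qw_cdf_cvg t : (fun n => qw_cdf a b c d alpha beta n t) @ \oo -->
  \int[lebesgue_measure]_(x in `]-oo, t]) f x.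
Proof.
apply: (@cvg_cdf_of_char R (fun n => (2 * n).+1) (fun n i => prob n (site n i))
   (fun n i => (site n i)%:~R / n%:R) f).
- by move=> n i; rewrite /qw_prob sumr_ge0// => j _; exact: sqr_ge0.
- exact: qw_prob_sum.
(* At time 0 the quotient by zero is 0, which does lie in [[-1, 1]]. *)
- move=> [|n] i i2; first by rewrite invr0 mulr0 lerN10 ler01.
  rewrite -ler_norml normrM normfV (ger0_norm (ler0n _ _)) ler_pdivrMr// mul1r.
  rewrite -intr_norm -[leRHS]/(n.+1%:Z%:~R) ler_int /site; lia.
- exact: integrable_konno_density.
- exact: konno_density_ge0.
- by rewrite /Rintegral integral_konno_density1.
- by move=> x; exact: konno_density_out.
- exact: cvg_expect_cos.
- exact: cvg_expect_sin.
Qed.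

End limit_law.

Theorem theorem3 (R : realType) (a b c d alpha beta : R[i]) :
  unitary2 a b c d ->
  a * b * c * d != 0 ->
  cabs alpha ^+ 2 + cabs beta ^+ 2 = 1 ->
  let f := qw_density a b alpha beta in
  let lam := qw_lambda a b alpha beta in
  (* the distribution function of Z *)
  let F := fun t : R =>
    fine (\int[lebesgue_measure]_(x in `]-oo, t]) (f x)%:E)%E in
  [/\ (* f is a probability density on R *)
      (measurable_fun setT f /\ forall x, 0 <= f x),
      (\int[lebesgue_measure]_x (f x)%:E = 1%:E)%E,
      (* X_n / n converges in distribution to Z with density f
         (the limit CDF is continuous, so convergence holds at every t) *)
      (forall t : R,
         (fun n => qw_cdf a b c d alpha beta n t) @ \oo -->
           F t),
      (* E(Z) *)
      (lebesgue_measure.-integrable setT (fun x => (x * f x)%:E) /\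
       (\int[lebesgue_measure]_x (x * f x)%:E
          = (- lam * (1 - Num.sqrt (1 - cabs a ^+ 2)))%:E)%E)
    & (* E(Z^2) *)
      (\int[lebesgue_measure]_x (x ^+ 2 * f x)%:E
          = (1 - Num.sqrt (1 - cabs a ^+ 2))%:E)%E].
Proof.
move=> U nz ab f lam F.
have fE : f = konno_density (cabs a) lam by [].
have [r0 r1 lr] := limit_law_params a b c d alpha beta U nz ab.
split.
- rewrite fE; split; first exact: measurable_konno_density.
  by move=> x; exact: konno_density_ge0.
- by rewrite fE; exact: integral_konno_density1.
- by move=> t; exact: qw_cdf_cvg.
- by rewrite fE; exact: integral_konno_mean.
- by rewrite fE; exact: integral_konno_second_moment.
Qed.
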